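(* Let $\mathbb k$ be a field and let $0<r\le s$ be real numbers. The functor $G:\mathcal B_{\le r}^{(2)}\to\mathcal F_{r\pi/s}$ induces an equivalence of categories $$\hat G:\mathcal B_{\le r}^{(2)}/F_s^{\wedge}\xrightarrow{\ \cong\ }\mathcal F_{r\pi/s}.$$
   Context: $\mathcal B_{\le r}^{(2)}$: the additive $\mathbb k$-category (objects finite ordered direct sums of indecomposables) with indecomposable objects $M(x,y)_+$ and $M(x,y)_-$ for $x,y\in\mathbb R$ with $|x-y|\le r$; $\mathrm{Hom}(M(x,y)_\epsilon,M(x',y')_{\epsilon'})=\mathbb k$ if $x\le x'$ and $y\le y'$, and $0$ otherwise; composition is multiplication of scalars. The morphism corresponding to $1\in\mathbb k$ is called basic. $F_s$ is the strictly additive $\mathbb k$-linear automorphism of $\mathcal B_{\le r}^{(2)}$ with $F_s(M(x,y)_\epsilon)=M(y+s,x+s)_{-\epsilon}$, sending basic morphisms to basic morphisms. The completed orbit category $\mathcal B_{\le r}^{(2)}/F_s^{\wedge}$ has the same objects as $\mathcal B_{\le r}^{(2)}$, with $\mathrm{Hom}(X,Y)=\prod_{n\in\mathbb Z}\mathcal B_{\le r}^{(2)}(X,F_s^nY)$ and composition $(g_j)(f_k)=(h_n)$, $h_n=\sum_{j+k=n}F_s^k g_j\circ f_k$ (a finite sum). $\mathcal F_c$: let $R=\mathbb k[[t]]$, $S^1=\mathbb R/2\pi\mathbb Z$. $\mathcal P_{S^1}$ is the additive $R$-category with indecomposable objects $P_{[x]}$, $[x]\in S^1$, and a morphism $e^\alpha:P_{[x]}\to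 P_{[x+\alpha]}$ for every real $\alpha\ge 0$, with $e^\alpha e^\beta=e^{\alpha+\beta}$ and $e^{2\pi}=$ multiplication by $t$; $\mathrm{Hom}(P_{[x]},P_{[y]})$ is the free $R$-module of rank 1 generated by $e^\alpha$ with $\alpha\ge0$ smallest such that $[x+\alpha]=[y]$. $\mathcal F$ is the category of pairs $(V,d)$, $V\in\mathcal P_{S^1}$, $d\in\mathrm{End}(V)$, $d^2=t$, with morphisms those of $\mathcal P_{S^1}$ commuting with $d$. For $x\le y\le x+2\pi$ put $E(x,y)=\left(P_{[x]}\oplus P_{[y]},\begin{bmatrix}0&e^{x+2\pi-y}\\ e^{y-x}&0\end{bmatrix}\right)$; then $E(x,y)=E(x+2\pi,y+2\pi)$ and $E(x,y)\cong E(y,x+2\pi)$. For $0<c\le\pi$ and $\theta=\pi-c$, $\mathcal F_c$ is the full additive subcategory of $\mathcal F$ generated by the $E(x,y)$ with $x+\theta\le y\le x+2\pi-\theta$. $G$: the strictly additive $\mathbb k$-linear functor with $GM(x,y)_+=E(\frac\pi s x,\frac\pi s y+\pi)$, $GM(x,y)_-=E(\frac\pi s y-\pi,\frac\pi s x)$, sending the basic morphism $f:M(x,y)_\epsilon\to M(a,b)_{\epsilon'}$ to $$Gf=\begin{bmatrix}0&1\\1&0\end{bmatrix}^{(\epsilon'=-)}\begin{bmatrix}e^{\frac\pi s(a-x)}&0\\0&e^{\frac\pi s(b-y)}\end{bmatrix}\begin{bmatrix}0&1\\1&0\end{bmatrix}^{(\epsilon=-)},$$ where $(\epsilon=-)$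 is $1$ if true and $0$ otherwise. One has $G\circ F_s=G$, and $\hat G$ is the functor equal to $G$ on objects and sending $(f_n)_n\in\prod_n\mathcal B_{\le r}^{(2)}(X,F_s^nY)$ to the ($t$-adically convergent) sum $\sum_n G f_n$. *)

(* Defs.v *)
From HB Require Import structures.
From mathcomp Require Import all_boot all_order all_algebra.
From mathcomp Require Import generic_quotient.
From mathcomp Require Import boolp classical_sets fsbigop reals trigo.
From mathcomp Require Import ring lra zify.
Set Implicit Arguments.
Unset Strict Implicit.
Unset Printing Implicit Defensive.
Import Order.TTheory GRing.Theory Num.Theory.
Local Open Scope ring_scope.

(* Small categories, with Leibniz equality of morphisms. *)
Record category := Category {
  ob :> Type;
  hom : ob -> ob -> Type;
  idm : forall X, hom X X;
  compm : forall X Y Z, hom Y Z -> hom X Y -> hom X Z;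
  comp1m : forall X Y (f : hom X Y), compm (idm Y) f = f;
  compm1 : forall X Y (f : hom X Y), compm f (idm X) = f;
  compmA : forall X Y Z T (h : hom Z T) (g : hom Y Z) (f : hom X Y),
    compm h (compm g f) = compm (compm h g) f }.
Arguments idm {c} X.
Arguments compm {c X Y Z} g f.

Record functor (C D : category) := Functor {
  fob :> C -> D;
  fhom : forall X Y : C, hom X Y -> hom (fob X) (fob Y);
  fhom1 : forall X, fhom (idm X) = idm (fob X);
  fhomM : forall X Y Z (g : hom Y Z) (f : hom X Y),
    fhom (compm g f) = compm (fhom g) (fhom f) }.
Arguments fhom {C D} f0 {X Y} f.

Definition id_functor (C : category) : functor C C :=
  @Functor C C id (fun _ _ f => f) (fun _ => erefl) (fun _ _ _ _ _ => erefl).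

Definition comp_functor (C D E : category) (G : functor D E)
    (F : functor C D) : functor C E :=
  @Functor C E (fun X => G (F X)) (fun _ _ f => fhom G (fhom F f))
    (fun X => etrans (congr1 (fhom G) (fhom1 F X)) (fhom1 G (F X)))
    (fun X Y Z g f => etrans (congr1 (fhom G) (fhomM F g f))
                             (fhomM G (fhom F g) (fhom F f))).

Definition isom (C : category) (X Y : C) : Prop :=
  exists (f : hom X Y) (g : hom Y X), compm g f = idm X /\ compm f g = idm Y.

Definition nat_isom (C D : category) (F G : functor C D) : Prop :=
  exists (u : forall X, hom (F X) (G X)) (v : forall X, hom (G X) (F X)),
    [/\ forall X, compm (v X) (u X) = idm (F X),
        forall X, compm (u X) (v X) = idm (G X) &
        forall X Y (f : hom X Y),
          compm (u Y) (fhom F f) = compm (fhom G f) (u X)].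

Definition is_equivalence (C D : category) (F : functor C D) : Prop :=
  exists H : functor D C,
    nat_isom (comp_functor H F) (id_functor C) /\
    nat_isom (comp_functor F H) (id_functor D).

Definition full_subcategory (C : category) (P : C -> Prop) : category :=
  @Category {X : C | P X} (fun X Y => hom (sval X) (sval Y))
    (fun X => idm (sval X)) (fun _ _ _ g f => compm g f)
    (fun _ _ f => comp1m f) (fun _ _ f => compm1 f)
    (fun _ _ _ _ h g f => compmA h g f).

(* Formal power series k[[t]]; the arrow type nat -> k already carries the
   pointwise ring structure, hence the wrapper. *)
Record fps (k : Type) := Fps { coefs : nat -> k }.

Section PowerSeries.
Variable k : fieldType.
Implicit Types a b c : fps k.

HB.instance Definition _ := gen_eqMixin (fps k).
HB.instance Definition _ := gen_choiceMixin (fps k).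

Lemma fpsP a b : (forall m, coefs a m = coefs b m) -> a = b.
Proof. by case: a b => [u] [v] /= uv; congr Fps; apply/funext. Qed.

Definition fps_add a b := Fps (fun m => coefs a m + coefs b m).
Definition fps_opp a := Fps (fun m => - coefs a m).
Definition fpsC (x : k) := Fps (fun m => if m == 0%N then x else 0).
Definition fps_mul a b :=
  Fps (fun m => \sum_(i < m.+1) coefs a i * coefs b (m - i)%N).

Fact fps_addA : associative fps_add.
Proof. by move=> a b c; apply/fpsP => m /=; rewrite addrA. Qed.
Fact fps_addC : commutative fps_add.
Proof. by move=> a b; apply/fpsP => m /=; rewrite addrC. Qed.
Fact fps_add0 : left_id (fpsC 0) fps_add.
Proof. by move=> a; apply/fpsP => m /=; rewrite if_same add0r. Qed.
Fact fps_addN : left_inverse (fpsC 0) fps_opp fps_add.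
Proof. by move=> a; apply/fpsP => m /=; rewrite if_same addNr. Qed.
HB.instance Definition _ :=
  GRing.isZmodule.Build (fps k) fps_addA fps_addC fps_add0 fps_addN.

Let tr n a : {poly k} := \poly_(i < n.+1) coefs a i.

Let coef_fps_mul n a b m : (m <= n)%N ->
  coefs (fps_mul a b) m = (tr n a * tr n b)`_m.
Proof.
move=> mn; rewrite coefM; apply: eq_bigr => i _ /=.
by rewrite !coef_poly !ltnS (leq_trans (leq_subr _ _) mn)
           (leq_trans _ mn) // -ltnS.
Qed.

Let coef_tr_mul n a b (p : {poly k}) m : (m <= n)%N ->
  (tr n (fps_mul a b) * p)`_m = (tr n a * tr n b * p)`_m.
Proof.
move=> mn; rewrite !(coefM _ p); apply: eq_bigr => i _; congr (_ * _).
have im : (i <= n)%N by rewrite (leq_trans _ mn) // -ltnS.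
by rewrite coef_poly ltnS im (coef_fps_mul _ _ im).
Qed.

Fact fps_mulC : commutative fps_mul.
Proof. by move=> a b; apply/fpsP => m; rewrite !(@coef_fps_mul m) // mulrC. Qed.
Fact fps_mulA : associative fps_mul.
Proof.
move=> a b c; apply/fpsP => m; rewrite fps_mulC !(@coef_fps_mul m) //.
by rewrite !coef_tr_mul // mulrC mulrA.
Qed.
Fact fps_mul1 : left_id (fpsC 1) fps_mul.
Proof.
move=> a; apply/fpsP => m /=; rewrite big_ord_recl /= subn0 mul1r big1 ?addr0 //.
by move=> i _; rewrite mul0r.
Qed.
Fact fps_mulDl : left_distributive fps_mul fps_add.
Proof.
move=> a b c; apply/fpsP => m /=; rewrite -big_split /=.
by apply: eq_bigr => i _; rewrite mulrDl.
Qed.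
Fact fps_1_neq0 : fpsC 1 != fpsC 0.
Proof.
by apply/eqP => /(congr1 (fun a => coefs a 0)) /= /eqP; rewrite oner_eq0.
Qed.
HB.instance Definition _ := GRing.Zmodule_isComNzRing.Build (fps k)
  fps_mulA fps_mulC fps_mul1 fps_mulDl fps_1_neq0.

Definition fpsX : fps k := Fps (fun m => (m == 1%N)%:R).

End PowerSeries.

(* Finite ordered (formal) direct sums of elements of T. *)
Record dsum (T : Type) := DSum { rank : nat; summand :> 'I_rank -> T }.

Section Circle.
Variable R : realType.
Implicit Types (x y b c : R).

Definition circle_rel x y : bool := (x - y) / (2 * pi) \is a Num.int.

Fact circle_rel_refl : reflexive circle_rel.
Proof. by move=> x; rewrite /circle_rel subrr mul0r rpred0. Qed.
Fact circle_rel_sym : symmetric circle_rel.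
Proof. by move=> x y; rewrite /circle_rel -opprB mulNr rpredN. Qed.
Fact circle_rel_trans : transitive circle_rel.
Proof.
move=> y x z xy yz; rewrite /circle_rel.
by rewrite -(subrKA y) mulrDl; exact: rpredD.
Qed.
Canonical circle_equiv :=
  EquivRel circle_rel circle_rel_refl circle_rel_sym circle_rel_trans.

(* S^1 = R / 2 pi Z *)
Definition circle := {eq_quot circle_equiv}%qT.
Definition cls x : circle := \pi_(circle)%qT x.

Lemma pi2_gt0 : 0 < 2 * pi :> R.
Proof. by rewrite mulr_gt0 // pi_gt0. Qed.

Lemma clsP x y : cls x = cls y <-> exists m : int, x = y + 2 * pi * m%:~R.
Proof.
have p0 := lt0r_neq0 pi2_gt0.
split=> [/eqP|[m ->]].
  rewrite /cls -[(_ == _)]/(\pi_(circle)%qT x == \pi_(circle)%qT y) pi_eq_quot.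
  move=> /intrP[m mE]; exists m; rewrite -mE.
  by rewrite mulrC divfK // addrC subrK.
apply/eqP; rewrite -[(_ == _)]/(\pi_(circle)%qT _ == \pi_(circle)%qT y) pi_eq_quot.
by rewrite /= /circle_rel addrC addKr mulrC mulKf // intr_int.
Qed.

Lemma cls_repr (p : circle) : cls (repr p) = p.
Proof. exact: reprK. Qed.

Lemma cls_period x (m : int) : cls (x + 2 * pi * m%:~R) = cls x.
Proof. by apply/clsP; exists m. Qed.

Lemma cls_periodD x : cls (x + 2 * pi) = cls x.
Proof. by rewrite -(cls_period x 1) mulr1. Qed.

Lemma cls_shift x y b : cls x = cls y -> cls (x + b) = cls (y + b).
Proof. by move=> /clsP[m ->]; apply/clsP; exists m; rewrite addrAC. Qed.

(* The smallest b >= 0 with [x + b] = q, where p = [x]. *)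
Definition gap (p q : circle) : R :=
  let u := (repr q - repr p) / (2 * pi) in 2 * pi * (u - (Num.floor u)%:~R).

Lemma gap_ge0 p q : 0 <= gap p q.
Proof. by rewrite mulr_ge0 ?(ltW pi2_gt0) // subr_ge0 floor_le. Qed.

Lemma gap_lt p q : gap p q < 2 * pi.
Proof.
rewrite /gap; set u := (_ / _); rewrite -[ltRHS]mulr1 ltr_pM2l ?pi2_gt0 //.
by have := floorD1_gt u; rewrite intrD ltrBlDl.
Qed.

Lemma cls_gap x q : cls (x + gap (cls x) q) = q.
Proof.
rewrite -[RHS]cls_repr -(cls_shift _ (cls_repr (cls x))).
apply/clsP; exists (- Num.floor ((repr q - repr (cls x)) / (2 * pi))).
rewrite /gap mulrBr [2 * pi * (_ / _)]mulrC divfK ?lt0r_neq0 ?pi2_gt0 //.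
by rewrite intrN mulrN; ring.
Qed.

Lemma gapP x q b : 0 <= b -> cls (x + b) = q ->
  exists n : nat, b = gap (cls x) q + 2 * pi * n%:R.
Proof.
move=> b0 xb; have := cls_gap x q; rewrite -{2}xb => /esym/clsP[m].
rewrite -addrA => /addrI bE; move: b0; rewrite bE.
case: m {bE} => n b0; first by exists n.
exfalso; move: b0; rewrite NegzE intrN mulrN subr_ge0 leNgt => /negP; apply.
apply: lt_le_trans (gap_lt _ _) _.
by rewrite -[leLHS]mulr1 ler_pM2l ?pi2_gt0 // ler1n.
Qed.

Lemma gap_min x q b : 0 <= b -> cls (x + b) = q -> gap (cls x) q <= b.
Proof.
by move=> b0 /(gapP b0)[n ->]; rewrite lerDl mulr_ge0 ?(ltW pi2_gt0).
Qed.

Lemma gap_add p q z :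
  exists n : nat, gap p q + gap q z = gap p z + 2 * pi * n%:R.
Proof.
rewrite -(cls_repr p); apply: gapP; first by rewrite addr_ge0 ?gap_ge0.
by rewrite addrA -{2}(cls_gap (repr p) q); exact: cls_gap.
Qed.

Lemma gapxx p : gap p p = 0.
Proof. by rewrite /gap subrr mul0r floor0 subrr mulr0. Qed.

End Circle.

Section Pcategory.
Variables (k : fieldType) (R : realType).
Local Notation circle := (circle R).

(* A morphism P_p -> P_q is a multiple c e^a of the generator e^a, a = gap p q,
   and is represented by its coefficient c in k[[t]]. For b >= 0, e^b has
   coefficient t ^ floor (b / (2 pi)), whatever its source. *)
Definition epow (b : R) : fps k := fpsX k ^+ Num.truncn (b / (2 * pi)).

Lemma epow0 : epow 0 = 1.
Proof. by rewrite /epow mul0r truncn0. Qed.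

Lemma epowD (b : R) (n : nat) : 0 <= b ->
  epow (b + 2 * pi * n%:R) = fpsX k ^+ n * epow b.
Proof.
move=> b0; rewrite /epow mulrDl [2 * pi * _ / _]mulrC mulKf ?lt0r_neq0 ?pi2_gt0 //.
have b0' : b / (2 * pi) \is Num.nneg.
  by rewrite qualifE/= divr_ge0 ?(ltW (pi2_gt0 R)).
by rewrite addrC (truncnD (natr_nat _ _) b0') natrK exprD.
Qed.

Lemma epow_gap (p q : circle) : epow (gap p q) = 1.
Proof.
rewrite /epow (_ : Num.truncn _ = 0%N) //; apply/truncn0Pn.
by rewrite -ltNge ltr_pdivrMr ?pi2_gt0 // mul1r gap_lt.
Qed.

Lemma epow_gapD (p q : circle) n : epow (gap p q + 2 * pi * n%:R) = fpsX k ^+ n.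
Proof. by rewrite epowD ?gap_ge0 // epow_gap mulr1. Qed.

Lemma epow_gapA (p q u v : circle) :
  epow (gap p q + gap q u) * epow (gap p u + gap u v) =
  epow (gap q u + gap u v) * epow (gap p q + gap q v).
Proof.
have [a aE] := gap_add p q u; have [b bE] := gap_add p u v.
have [c cE] := gap_add q u v; have [d dE] := gap_add p q v.
rewrite aE bE cE dE !epow_gapD -!exprD; congr (_ ^+ _).
apply/eqP; rewrite -(eqr_nat R) !natrD.
apply/eqP/(mulfI (lt0r_neq0 (pi2_gt0 R))); lra.
Qed.

Lemma epow_comp (x b c : R) (q u : circle) : 0 <= b -> 0 <= c ->
  cls (x + b) = q -> cls (x + b + c) = u ->
  epow c * epow b * epow (gap (cls x) q + gap q u) = epow (b + c).
Proof.
move=> b0 c0 xb xc.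
have [m ->] := gapP b0 xb; have [n ->] := gapP c0 xc; rewrite xb.
have [l lE] := gap_add (cls x) q u.
have -> : gap (cls x) q + 2 * pi * m%:R + (gap q u + 2 * pi * n%:R) =
  gap (cls x) u + 2 * pi * (l + m + n)%:R by rewrite !natrD; lra.
by rewrite lE !epow_gapD -!exprD; congr (_ ^+ _); lia.
Qed.

(* Composition of morphisms of direct sums: the coefficient of e^a e^b is that of
   e^(a + b). The entry f j h is the component X h -> Y j. *)
Definition Pcomp m n l (X : 'I_m -> circle) (Y : 'I_n -> circle)
    (Z : 'I_l -> circle) (g : 'M[fps k]_(l, n)) (f : 'M[fps k]_(n, m)) :=
  \matrix_(i, h) \sum_j
    g i j * f j h * epow (gap (X h) (Y j) + gap (Y j) (Z i)).

Lemma Pcomp1m (X Y : dsum circle) (f : 'M_(rank Y, rank X)) :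
  Pcomp X Y Y 1%:M f = f.
Proof.
apply/matrixP => i h; rewrite mxE (bigD1 i) //= big1 => [|j ji].
  by rewrite mxE eqxx mul1r gapxx !addr0 epow_gap mulr1.
by rewrite mxE eq_sym (negPf ji) !mul0r.
Qed.

Lemma Pcompm1 (X Y : dsum circle) (f : 'M_(rank Y, rank X)) :
  Pcomp X X Y f 1%:M = f.
Proof.
apply/matrixP => i h; rewrite mxE (bigD1 h) //= big1 => [|j ji].
  by rewrite mxE eqxx mulr1 gapxx !add0r addr0 epow_gap mulr1.
by rewrite mxE (negPf ji) mulr0 mul0r.
Qed.

Lemma PcompA (X Y Z T : dsum circle) (h : 'M_(rank T, rank Z))
    (g : 'M_(rank Z, rank Y)) (f : 'M_(rank Y, rank X)) :
  Pcomp X Z T h (Pcomp X Y Z g f) = Pcomp X Y T (Pcomp Y Z T h g) f.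
Proof.
apply/matrixP => i l; rewrite !mxE.
under eq_bigr do rewrite mxE mulr_sumr mulr_suml.
rewrite exchange_big /=; apply: eq_bigr => j _.
rewrite mxE !mulr_suml; apply: eq_bigr => u _.
have := epow_gapA (X l) (Y j) (Z u) (T i).
move: (epow _) (epow _) (epow _) (epow _) => a b c d abcd.
rewrite !mulrA -[LHS]mulrA abcd.
by ring.
Qed.

Definition Pcat : category :=
  @Category (dsum circle) (fun X Y => 'M[fps k]_(rank Y, rank X))
    (fun X => 1%:M) (fun X Y Z g f => Pcomp X Y Z g f)
    Pcomp1m Pcompm1 PcompA.

End Pcategory.

Section Fcategory.
Variables (k : fieldType) (R : realType).
Local Notation circle := (circle R).
Local Notation epow := (@epow k R).
Implicit Types (x y b c : R).

(* A pair (V, d) with d ^ 2 = t. *)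
Record mf := Mf {
  mf_ob :> dsum circle;
  mf_d : 'M[fps k]_(rank mf_ob);
  mf_dP : Pcomp mf_ob mf_ob mf_ob mf_d mf_d = (fpsX k)%:M }.

Definition is_mf_hom (V W : mf) (f : 'M[fps k]_(rank W, rank V)) : bool :=
  Pcomp V W W (mf_d W) f == Pcomp V V W f (mf_d V).
Definition mf_hom (V W : mf) := {f : 'M[fps k]_(rank W, rank V) | is_mf_hom f}.

Fact mf_id_subproof (V : mf) : @is_mf_hom V V 1%:M.
Proof. by rewrite /is_mf_hom Pcomp1m Pcompm1. Qed.
Definition mf_id V : mf_hom V V := Sub _ (mf_id_subproof V).

Fact mf_comp_subproof (U V W : mf) (g : mf_hom V W) (f : mf_hom U V) :
  @is_mf_hom U W (Pcomp U V W (val g) (val f)).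
Proof.
apply/eqP; rewrite PcompA (eqP (valP g)) -PcompA (eqP (valP f)).
by rewrite PcompA.
Qed.
Definition mf_comp U V W (g : mf_hom V W) (f : mf_hom U V) : mf_hom U W :=
  Sub _ (mf_comp_subproof g f).

Fact mf_comp1m V W (f : mf_hom V W) : mf_comp (mf_id W) f = f.
Proof. by apply: val_inj; rewrite /= Pcomp1m. Qed.
Fact mf_compm1 V W (f : mf_hom V W) : mf_comp f (mf_id V) = f.
Proof. by apply: val_inj; rewrite /= Pcompm1. Qed.
Fact mf_compA U V W Z (h : mf_hom W Z) (g : mf_hom V W) (f : mf_hom U V) :
  mf_comp h (mf_comp g f) = mf_comp (mf_comp h g) f.
Proof. by apply: val_inj; rewrite /= PcompA. Qed.

Definition Fcat : category :=
  @Category mf mf_hom mf_id mf_comp mf_comp1m mf_compm1 mf_compA.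

Definition dsum_cat T n (V : 'I_n -> dsum T) : dsum T :=
  @DSum T (\sum_i rank (V i))
    (fun j => V (tagnat.sig1 j) (tagnat.sig2 j)).

Lemma Pcomp_mxblock m n l (X : 'I_m -> dsum circle) (Y : 'I_n -> dsum circle)
    (Z : 'I_l -> dsum circle)
    (B : forall i j, 'M[fps k]_(rank (Z i), rank (Y j)))
    (A : forall j h, 'M[fps k]_(rank (Y j), rank (X h))) :
  Pcomp (dsum_cat X) (dsum_cat Y) (dsum_cat Z)
    (\mxblock_(i, j) B i j) (\mxblock_(j, h) A j h) =
  \mxblock_(i, h) \sum_j Pcomp (X h) (Y j) (Z i) (B i j) (A j h).
Proof.
apply/matrixP => a b; rewrite !mxE summxE.
under [RHS]eq_bigr do rewrite mxE.
rewrite sig_big_dep/= (reindex _ tagnat.sig_bij_on)/=.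
by apply: eq_bigr => j _; rewrite !mxE.
Qed.

Lemma Pcomp0m (X Y Z : dsum circle) (f : 'M[fps k]_(rank Y, rank X)) :
  Pcomp X Y Z 0 f = 0.
Proof.
by apply/matrixP => i j; rewrite !mxE big1 // => l _; rewrite mxE !mul0r.
Qed.

Lemma Pcompm0 (X Y Z : dsum circle) (g : 'M[fps k]_(rank Z, rank Y)) :
  Pcomp X Y Z g 0 = 0.
Proof.
by apply/matrixP => i j; rewrite !mxE big1 // => l _; rewrite mxE mulr0 mul0r.
Qed.

Lemma Pcomp_mxdiagl n l (Y : 'I_n -> dsum circle) (X : 'I_l -> dsum circle)
    (D : forall i, 'M[fps k]_(rank (Y i)))
    (A : forall i j, 'M[fps k]_(rank (Y i), rank (X j))) :
  Pcomp (dsum_cat X) (dsum_cat Y) (dsum_cat Y) (\mxdiag_i D i)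
     (\mxblock_(i, j) A i j) =
  \mxblock_(i, j) Pcomp (X j) (Y i) (Y i) (D i) (A i j).
Proof.
rewrite /mxdiag Pcomp_mxblock; apply: eq_mxblock => i j.
rewrite (bigD1 i) //= eqxx conform_mx_id big1 ?addr0 // => h hi.
by rewrite eq_sym (negPf hi) Pcomp0m.
Qed.

Lemma Pcomp_mxdiagr n l (Y : 'I_n -> dsum circle) (X : 'I_l -> dsum circle)
    (D : forall i, 'M[fps k]_(rank (X i)))
    (A : forall i j, 'M[fps k]_(rank (Y i), rank (X j))) :
  Pcomp (dsum_cat X) (dsum_cat X) (dsum_cat Y)
     (\mxblock_(i, j) A i j) (\mxdiag_i D i) =
  \mxblock_(i, j) Pcomp (X j) (X j) (Y i) (A i j) (D j).
Proof.
rewrite /mxdiag Pcomp_mxblock; apply: eq_mxblock => i j.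
rewrite (bigD1 j) //= eqxx conform_mx_id big1 ?addr0 // => h hi.
by rewrite (negPf hi) Pcompm0.
Qed.

Fact mf_dsum_subproof n (V : 'I_n -> mf) :
  let W := dsum_cat V in
  Pcomp W W W (\mxdiag_i mf_d (V i)) (\mxdiag_i mf_d (V i)) = (fpsX k)%:M.
Proof.
rewrite /= {2}/mxdiag Pcomp_mxdiagl -[RHS]mxdiagZ /mxdiag.
apply: eq_mxblock => i j; case: eqP => [->|]; last by rewrite Pcompm0.
by rewrite !conform_mx_id mf_dP.
Qed.
Definition mf_dsum n (V : 'I_n -> mf) : mf := Mf (mf_dsum_subproof V).

Definition dsum2 T (p q : T) : dsum T :=
  DSum (fun i : 'I_2 => if i == 0 then p else q).

(* [[a, b], [c, d]] *)
Definition mx2 (K : Type) (a b c d : K) : 'M[K]_2 :=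
  \matrix_(i, j) if i == 0 then if j == 0 then a else b
                 else if j == 0 then c else d.

Lemma mx2P (K : Type) (A B : 'M[K]_2) : A 0 0 = B 0 0 -> A 0 1 = B 0 1 ->
  A 1 0 = B 1 0 -> A 1 1 = B 1 1 -> A = B.
Proof.
move=> h00 h01 h10 h11; apply/matrixP => i j.
have I2 (u : 'I_2) : u = 0 \/ u = 1.
  by case: u => [[|[|u]] hu] //; [left|right]; apply: val_inj.
by case: (I2 i) => ->; case: (I2 j) => ->.
Qed.

Lemma epow_loop x y : x <= y <= x + 2 * pi ->
  epow (x + 2 * pi - y) * epow (y - x)
    * epow (gap (cls x) (cls y) + gap (cls y) (cls x)) = fpsX k.
Proof.
move=> /andP[xy yx]; rewrite epow_comp ?subr_ge0 //.
- rewrite (_ : _ + _ = 0 + 2 * pi * 1%:R); last by ring.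
  by rewrite epowD // epow0 mulr1.
- by rewrite addrC subrK.
- by rewrite (_ : _ + _ = x + 2 * pi) ?cls_periodD //; ring.
Qed.

Fact mfE_subproof x y : x <= y <= x + 2 * pi ->
  let V := dsum2 (cls x) (cls y) in
  Pcomp V V V (mx2 0 (epow (x + 2 * pi - y)) (epow (y - x)) 0)
              (mx2 0 (epow (x + 2 * pi - y)) (epow (y - x)) 0) = (fpsX k)%:M.
Proof.
move=> h /=; apply: mx2P; rewrite !mxE !big_ord_recl big_ord0 !mxE /=
  ?mul0r ?mulr0 ?mul0r ?addr0 ?add0r //.
  exact: epow_loop.
by rewrite [epow (y - x) * _]mulrC [gap (cls y) _ + _]addrC; exact: epow_loop.
Qed.

Definition mfE x y (h : x <= y <= x + 2 * pi) : mf := Mf (mfE_subproof h).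

Lemma eq_mfE x y (h : x <= y <= x + 2 * pi) x' y' (h' : x' <= y' <= x' + 2 * pi) :
  cls x = cls x' -> cls y = cls y' -> y - x = y' - x' -> mfE h = mfE h'.
Proof.
move=> ex ey exy; rewrite /mfE; move: (mfE_subproof h) (mfE_subproof h').
have -> : x + 2 * pi - y = 2 * pi - (y - x) by ring.
have -> : x' + 2 * pi - y' = 2 * pi - (y' - x') by ring.
rewrite /= ex ey exy => p p'; congr Mf; exact: Prop_irrelevance.
Qed.

(* The full additive subcategory generated by the E(x, y) with
   x + theta <= y <= x + 2 pi - theta, theta = pi - c, closed under
   isomorphism. *)
Definition in_Fc c (X : Fcat) : Prop :=
  let theta := pi - c in
  exists n (x y : 'I_n -> R) (h : forall i, x i <= y i <= x i + 2 * pi),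
    (forall i, x i + theta <= y i <= x i + 2 * pi - theta) /\
    isom X (mf_dsum (fun i => mfE (h i))).

Definition Fc c : category := full_subcategory (in_Fc c).

End Fcategory.

Section Bcategory.
Variables (k : fieldType) (R : realType) (r : R).

(* M(x, y)_+ (pos = true) and M(x, y)_- (pos = false) *)
Record ind := Ind {
  fstc : R; sndc : R; pos : bool; indP : `|fstc - sndc| <= r }.
Implicit Types M N : ind.

Lemma eq_ind M N : fstc M = fstc N -> sndc M = sndc N -> pos M = pos N -> M = N.
Proof.
case: M N => [x y e h] [x' y' e' h'] /= ex ey ee.
by move: h h'; rewrite ex ey ee => h h'; congr Ind; apply: bool_irrelevance.
Qed.

Definition ind_le M N : bool := (fstc M <= fstc N) && (sndc M <= sndc N).

Lemma ind_le_refl M : ind_le M M.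
Proof. by rewrite /ind_le !lexx. Qed.

Lemma ind_le_trans : transitive ind_le.
Proof.
move=> N M L /andP[a b] /andP[c d]; apply/andP; split.
  exact: le_trans a c.
exact: le_trans b d.
Qed.

(* Hom(M, N) is k when ind_le M N and 0 otherwise, so that a morphism of direct
   sums is a matrix of scalars with constrained support; the entry A i j is the
   component X j -> Y i. *)
Definition is_Bhom (X Y : dsum ind) (A : 'M[k]_(rank Y, rank X)) : bool :=
  [forall i, forall j, (A i j != 0) ==> ind_le (X j) (Y i)].
Definition Bhom (X Y : dsum ind) :=
  {A : 'M[k]_(rank Y, rank X) | is_Bhom A}.

Lemma is_BhomP (X Y : dsum ind) (A : 'M[k]_(rank Y, rank X)) :
  reflect (forall i j, ~~ ind_le (X j) (Y i) -> A i j = 0) (@is_Bhom X Y A).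
Proof.
apply: (iffP forallP) => [h i j|h i].
  by have /forallP/(_ j)/implyP hij := h i; apply: contraNeq => /hij.
by apply/forallP => j; apply/implyP; apply: contraNT => /h ->.
Qed.

Lemma is_Bhom_mul (X Y Z : dsum ind) (B : 'M[k]_(rank Z, rank Y))
    (A : 'M[k]_(rank Y, rank X)) :
  is_Bhom B -> @is_Bhom X Y A -> @is_Bhom X Z (B *m A).
Proof.
move=> /is_BhomP hB /is_BhomP hA; apply/is_BhomP => i j nle.
rewrite mxE big1 // => l _.
have [le1|/hA->] := boolP (ind_le (X j) (Y l)); last by rewrite mulr0.
have [le2|/hB->] := boolP (ind_le (Y l) (Z i)); last by rewrite mul0r.
by rewrite (ind_le_trans le1 le2) in nle.
Qed.

Fact Bid_subproof (X : dsum ind) : @is_Bhom X X 1%:M.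
Proof.
apply/is_BhomP => i j; rewrite mxE; case: eqP => [->|//].
by rewrite ind_le_refl.
Qed.
Definition Bid X : Bhom X X := Sub _ (Bid_subproof X).

Definition Bcomp X Y Z (g : Bhom Y Z) (f : Bhom X Y) : Bhom X Z :=
  Sub (val g *m val f) (is_Bhom_mul (valP g) (valP f)).

Fact Bcomp1m X Y (f : Bhom X Y) : Bcomp (Bid Y) f = f.
Proof. by apply: val_inj; rewrite /= mul1mx. Qed.
Fact Bcompm1 X Y (f : Bhom X Y) : Bcomp f (Bid X) = f.
Proof. by apply: val_inj; rewrite /= mulmx1. Qed.
Fact BcompA X Y Z T (h : Bhom Z T) (g : Bhom Y Z) (f : Bhom X Y) :
  Bcomp h (Bcomp g f) = Bcomp (Bcomp h g) f.
Proof. by apply: val_inj; rewrite /= mulmxA. Qed.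

Definition Bcat : category :=
  @Category (dsum ind) Bhom Bid Bcomp Bcomp1m Bcompm1 BcompA.

Variable s : R.

Fact Fs_ind_subproof (u : R) M : `|(sndc M + u) - (fstc M + u)| <= r.
Proof. by rewrite opprD addrACA subrr addr0 distrC indP. Qed.
Definition Fs_ind M :=
  @Ind (sndc M + s) (fstc M + s) (~~ pos M) (Fs_ind_subproof s M).
Definition Fs_ind_inv M :=
  @Ind (sndc M - s) (fstc M - s) (~~ pos M) (Fs_ind_subproof (- s) M).

Lemma Fs_indK : cancel Fs_ind Fs_ind_inv.
Proof. by move=> M; apply: eq_ind; rewrite /= ?addrK ?negbK. Qed.
Lemma Fs_ind_invK : cancel Fs_ind_inv Fs_ind.
Proof. by move=> M; apply: eq_ind; rewrite /= ?subrK ?negbK. Qed.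

Definition Fs_iter (n : int) M : ind :=
  match n with
  | Posz m => iter m Fs_ind M
  | Negz m => iter m.+1 Fs_ind_inv M
  end.

Lemma Fs_iterS n M : Fs_iter (n + 1) M = Fs_ind (Fs_iter n M).
Proof.
case: n => [m|[|m]]; first by rewrite -PoszD addn1.
  by rewrite (_ : Negz 0 + 1 = 0) //; exact/esym/Fs_ind_invK.
rewrite (_ : Negz m.+1 + 1 = Negz m); last by lia.
exact/esym/Fs_ind_invK.
Qed.

Lemma Fs_iterB n M : Fs_iter (n - 1) M = Fs_ind_inv (Fs_iter n M).
Proof. by rewrite -{2}(subrK 1 n) Fs_iterS Fs_indK. Qed.

Lemma Fs_iterD m n M : Fs_iter (m + n) M = Fs_iter m (Fs_iter n M).
Proof.
elim: m => [|m IH|m IH]; first by rewrite add0r.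
  by rewrite intS (addrC 1) addrAC !Fs_iterS IH.
by rewrite intS opprD (addrC (- 1)) addrAC !Fs_iterB IH.
Qed.

Lemma ind_le_Fs n M N : ind_le (Fs_iter n M) (Fs_iter n N) = ind_le M N.
Proof.
elim: n => [//|m IH|m IH].
  by rewrite intS (addrC 1) !Fs_iterS -IH /ind_le /= !lerD2r andbC.
by rewrite intS opprD (addrC (- 1)) !Fs_iterB -IH /ind_le /= !lerD2r andbC.
Qed.

Lemma Fs_iter_sum n M :
  fstc (Fs_iter n M) + sndc (Fs_iter n M) = fstc M + sndc M + 2 * s * n%:~R.
Proof.
elim: n => [|m IH|m IH]; first by rewrite mulr0 addr0.
  by rewrite intS (addrC 1) Fs_iterS /= intrD mulrDr; lra.
by rewrite intS opprD (addrC (- 1)) Fs_iterB /= intrB mulrBr; lra.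
Qed.

(* F_s ^ n; as F_s is strictly additive and preserves basic morphisms, it acts
   on morphisms by the identity on matrices. *)
Definition Fspow_ob n (X : dsum ind) : dsum ind :=
  DSum (fun i => Fs_iter n (X i)).

Fact Fspow_subproof n X Y (f : Bhom X Y) :
  @is_Bhom (Fspow_ob n X) (Fspow_ob n Y) (val f).
Proof. by apply/is_BhomP => i j; rewrite ind_le_Fs; apply/is_BhomP/(valP f). Qed.

Definition Fspow_hom n X Y (f : Bhom X Y) : Bhom (Fspow_ob n X) (Fspow_ob n Y) :=
  Sub _ (Fspow_subproof n f).

Definition Fspow (n : int) : functor Bcat Bcat.
refine (@Functor Bcat Bcat (Fspow_ob n) (Fspow_hom n) _ _).
- by move=> X; apply: val_inj.
- by move=> X Y Z g f; apply: val_inj.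
Defined.

Lemma Fspow_obD m n X : Fspow_ob m (Fspow_ob n X) = Fspow_ob (m + n) X.
Proof.
rewrite /Fspow_ob; congr DSum => /=.
by apply/funext => i; rewrite Fs_iterD.
Qed.

End Bcategory.

Lemma fsum_seq (V : nmodType) (F : int -> V) (e : seq int) :
  uniq e -> (forall l, F l != 0 -> l \in e) ->
  \sum_(l \in [set: int]) F l = \sum_(l <- e) F l.
Proof.
move=> ue Fe; rewrite (fsbigE e) //; first by apply: eq_bigl => l; rewrite in_setT.
by move=> l _; apply: contraNeq => /Fe.
Qed.

Definition intvl (a b : int) : seq int := [seq a + i%:Z | i <- iota 0 `|b - a|.+1].

Lemma intvl_uniq a b : uniq (intvl a b).
Proof. by rewrite map_inj_uniq ?iota_uniq // => i j /addrI[]. Qed.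

Lemma mem_intvl a b l : a <= l <= b -> l \in intvl a b.
Proof.
move=> alb; apply/mapP; exists `|l - a|%N; last by lia.
by rewrite mem_iota; lia.
Qed.

Section Orbit.
Variables (k : fieldType) (R : realType) (r s : R).
Local Notation ind := (ind r).
Local Notation Bhom := (@Bhom k R r).
Local Notation Fspow_ob := (Fspow_ob s).

Definition orbit_hom (X Y : dsum ind) := forall n : int, Bhom X (Fspow_ob n Y).

Fact orbit_id_subproof X (n : int) :
  @is_Bhom k R r X (Fspow_ob n X) (if n == 0 then 1%:M else 0).
Proof.
case: eqP => [->|_]; first exact: (valP (Bid k X)).
by apply/is_BhomP => i j; rewrite mxE.
Qed.
Definition orbit_id X : orbit_hom X X := fun n => Sub _ (orbit_id_subproof X n).

(* F ^ l (F ^ (n - l) Z) = F ^ n Z, see Fspow_obD, and all the direct sums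
   F ^ n Z have the same rank as Z, so that the summands are matrices of the same
   format. The sum has finitely many nonzero terms when s > 0. *)
Definition orbit_comp_mx X Y Z (g : orbit_hom Y Z) (f : orbit_hom X Y) (n : int)
    : 'M[k]_(rank Z, rank X) :=
  \sum_(l \in [set: int])
    (val (Bcomp (Fspow_hom s l (g (n - l))) (f l)) : 'M[k]_(rank Z, rank X)).

Fact orbit_comp_subproof X Y Z (g : orbit_hom Y Z) (f : orbit_hom X Y) n :
  @is_Bhom k R r X (Fspow_ob n Z) (orbit_comp_mx g f n).
Proof.
rewrite /orbit_comp_mx; apply: (big_ind (fun A => @is_Bhom k R r X (Fspow_ob n Z) A)).
- by apply/is_BhomP => i j; rewrite mxE.
- move=> A B /is_BhomP hA /is_BhomP hB; apply/is_BhomP => i j nle.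
  by rewrite mxE hA // hB // addr0.
move=> l _; have /is_BhomP h := valP (Bcomp (Fspow_hom s l (g (n - l))) (f l)).
apply/is_BhomP => i j; have := h i j.
by rewrite /= -Fs_iterD [l + _]addrC subrK.
Qed.
Definition orbit_comp X Y Z (g : orbit_hom Y Z) (f : orbit_hom X Y)
  : orbit_hom X Z := fun n => Sub _ (orbit_comp_subproof g f n).

Lemma orbit_homP X Y (f g : orbit_hom X Y) :
  (forall n, val (f n) = val (g n) :> 'M[k]_(rank Y, rank X)) -> f = g.
Proof. by move=> fg; apply: functional_extensionality_dep => n; exact: val_inj. Qed.

Lemma orbit_comp1m X Y (f : orbit_hom X Y) : orbit_comp (orbit_id Y) f = f.
Proof.
apply: orbit_homP => n; rewrite /= /orbit_comp_mx (@fsum_seq _ _ [:: n]) //.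
  by rewrite big_seq1 /= subrr eqxx mul1mx.
move=> l; rewrite inE /= subr_eq0; have [//|_] := eqVneq n l.
by rewrite mul0mx eqxx.
Qed.

Lemma orbit_compm1 X Y (f : orbit_hom X Y) : orbit_comp f (orbit_id X) = f.
Proof.
apply: orbit_homP => n; rewrite /= /orbit_comp_mx (@fsum_seq _ _ [:: 0]) //.
  by rewrite big_seq1 /= mulmx1 subr0.
by move=> l; rewrite inE /=; have [//|_] := eqVneq l 0; rewrite mulmx0 eqxx.
Qed.

Hypothesis s_gt0 : 0 < s.

(* Completed products over Z are supported on half-lines. *)
Lemma orbit_bound X Y : exists a : int, forall (f : orbit_hom X Y) n,
  val (f n) != 0 -> a <= n.
Proof.
pose v (M : ind) : R := fstc M + sndc M.
pose b := \max_(i < rank Y) \max_(j < rank X)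
  Num.bound ((v (X j) - v (Y i)) / (2 * s)).
exists (- b%:Z) => f n; apply: contraNT => nb.
have /is_BhomP h := valP (f n); apply/eqP/matrixP => i j; rewrite mxE h //.
apply: contra nb => /andP[h1 h2].
have : v (X j) <= v (Fs_iter s n (Y i)) by rewrite lerD.
rewrite {2}/v Fs_iter_sum -/(v _) -lerBlDl mulrC -ler_pdivrMr ?mulr_gt0 // => hn.
have hb : (Num.bound ((v (X j) - v (Y i)) / (2 * s)) <= b)%N.
  rewrite /b; apply: leq_trans (leq_bigmax i); exact: (leq_bigmax j).
have : - (b%:Z)%:~R <= n%:~R :> R.
  apply: le_trans hn; rewrite lerNl.
  apply: le_trans (ler_norm _) _; rewrite normrN.
  apply/ltW; apply: (lt_le_trans (truncnS_gt _)).
  by rewrite ler_nat.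
by rewrite -intrN ler_int.
Qed.

Lemma orbit_compA X Y Z T (h : orbit_hom Z T) (g : orbit_hom Y Z)
    (f : orbit_hom X Y) :
  orbit_comp h (orbit_comp g f) = orbit_comp (orbit_comp h g) f.
Proof.
have [a ha] := orbit_bound X Y; have [b hb] := orbit_bound Y Z.
have [c hc] := orbit_bound Z T.
apply: orbit_homP => n; rewrite /= {1 2}/orbit_comp_mx /=.
pose e1 := intvl a (n - b - c); pose e2 := intvl (a + b) (n - c).
pose A l := val (f l) : 'M[k]_(rank Y, rank X).
pose B l := val (g l) : 'M[k]_(rank Z, rank Y).
pose C l := val (h l) : 'M[k]_(rank T, rank Z).
have nA l : A l != 0 -> a <= l by exact: ha.
have nB l : B l != 0 -> b <= l by exact: hb.
have nC l : C l != 0 -> c <= l by exact: hc.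
have nz m n' p (P : 'M[k]_(m, n')) (Q : 'M[k]_(n', p)) :
    P *m Q != 0 -> P != 0 /\ Q != 0.
  move=> PQ; split; apply: contraNneq PQ => ->; by rewrite ?mul0mx ?mulmx0.
have gfE l : orbit_comp_mx g f l = \sum_(m \in [set: int]) (B (l - m) *m A m) by [].
have hgE l : orbit_comp_mx h g l = \sum_(m \in [set: int]) (C (l - m) *m B m) by [].
have gfle l : orbit_comp_mx g f l != 0 -> a + b <= l.
  apply: contraNT => lab; rewrite gfE fsbig1 // => m _; apply/eqP.
  by apply: contraNT lab => /nz[/nB ? /nA ?]; lia.
have hgle l : orbit_comp_mx h g l != 0 -> b + c <= l.
  apply: contraNT => lab; rewrite hgE fsbig1 // => m _; apply/eqP.
  by apply: contraNT lab => /nz[/nC ? /nB ?]; lia.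
rewrite (@fsum_seq _ _ e2) ?intvl_uniq //; last first.
  by move=> l /nz[/nC ? /gfle ?]; apply: mem_intvl; lia.
rewrite (@fsum_seq _ _ e1) ?intvl_uniq //; last first.
  by move=> l /nz[/hgle ? /nA ?]; apply: mem_intvl; lia.
transitivity (\sum_(l <- e2) \sum_(m <- e1) C (n - l) *m (B (l - m) *m A m)).
  apply: eq_bigr => l _; rewrite -mulmx_sumr gfE.
  rewrite -/(C (n - l)); have [->|/nC lc] := eqVneq (C (n - l)) 0; first by rewrite !mul0mx.
  congr (_ *m _); apply: fsum_seq; first exact: intvl_uniq.
  by move=> m /nz[/nB ? /nA ?]; apply: mem_intvl; lia.
rewrite exchange_big; apply: eq_bigr => m _ /=.
have [A0|/nA ma] := eqVneq (A m) 0.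
  by rewrite -/(A m) A0 mulmx0 big1 // => l _; rewrite !mulmx0.
under eq_bigr do rewrite mulmxA.
rewrite -mulmx_suml; congr (_ *m _).
rewrite hgE (reindex_fsbigT (fun l => l - m)) /=; last first.
  by exists (fun l => l + m) => l; rewrite ?subrK ?addrK.
rewrite (@fsum_seq _ _ e2) ?intvl_uniq //; last first.
  by move=> l /nz[/nC ? /nB ?]; apply: mem_intvl; lia.
by apply: eq_bigr => l _; rewrite (_ : n - m - (l - m) = n - l) //; lia.
Qed.

Definition orbit_cat : category :=
  @Category (dsum ind) orbit_hom orbit_id orbit_comp
    orbit_comp1m orbit_compm1 orbit_compA.

End Orbit.

Section SeriesFacts.
Variable k : fieldType.
Implicit Types a b : fps k.

Lemma coefsD a b m : coefs (a + b) m = coefs a m + coefs b m.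
Proof. by []. Qed.

Lemma coefs0 m : coefs (0 : fps k) m = 0.
Proof. by rewrite /= if_same. Qed.

Lemma coefs_sum (I : Type) (e : seq I) (F : I -> fps k) m :
  coefs (\sum_(i <- e) F i) m = \sum_(i <- e) coefs (F i) m.
Proof.
elim: e => [|i e IH]; first by rewrite !big_nil coefs0.
by rewrite !big_cons coefsD IH.
Qed.

Lemma coefsM a b m :
  coefs (a * b) m = \sum_(i < m.+1) coefs a i * coefs b (m - i)%N.
Proof. by []. Qed.

Lemma coefsCM (c : k) a m : coefs (fpsC c * a) m = c * coefs a m.
Proof.
rewrite coefsM big_ord_recl /= subn0 big1 ?addr0 // => i _.
by rewrite mul0r.
Qed.

Lemma coefsXn n m : coefs (fpsX k ^+ n) m = (m == n)%:R.
Proof.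
elim: n m => [|n IH] m; first by rewrite expr0 /=; case: eqP.
rewrite exprS coefsM; case: m => [|m].
  by rewrite big_ord1 /= mul0r.
rewrite big_ord_recl mul0r add0r big_ord_recl /= mul1r subSS subn0 IH eqSS.
by rewrite big1 ?addr0 // => i _; rewrite /= mul0r.
Qed.

Lemma fpsC0 : fpsC 0 = 0 :> fps k. Proof. by []. Qed.
Lemma fpsC1 : fpsC 1 = 1 :> fps k. Proof. by []. Qed.

Lemma fpsCD (c d : k) : fpsC (c + d) = fpsC c + fpsC d.
Proof. by apply: fpsP => m /=; case: eqP; rewrite ?addr0. Qed.

Lemma fpsCM (c d : k) : fpsC (c * d) = fpsC c * fpsC d.
Proof. by apply: fpsP => m; rewrite coefsCM /=; case: eqP; rewrite ?mulr0. Qed.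

Lemma fpsC_sum (I : Type) (e : seq I) (F : I -> k) :
  fpsC (\sum_(i <- e) F i) = \sum_(i <- e) fpsC (F i).
Proof. exact: (big_morph _ fpsCD fpsC0). Qed.

End SeriesFacts.

Lemma Pcomp_dsum2 (k : fieldType) (R : realType) (p1 p2 q1 q2 u1 u2 : circle R)
    (a b c d a' b' c' d' : fps k) :
  let e (p q u : circle R) := epow k (gap p q + gap q u) in
  Pcomp (dsum2 p1 p2) (dsum2 q1 q2) (dsum2 u1 u2)
    (mx2 a b c d) (mx2 a' b' c' d') =
  mx2 (a * a' * e p1 q1 u1 + b * c' * e p1 q2 u1)
      (a * b' * e p2 q1 u1 + b * d' * e p2 q2 u1)
      (c * a' * e p1 q1 u2 + d * c' * e p1 q2 u2)
      (c * b' * e p2 q1 u2 + d * d' * e p2 q2 u2).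
Proof.
by apply: mx2P; rewrite !mxE !big_ord_recl big_ord0 !mxE /= ?addr0.
Qed.

Lemma epow_compE (k : fieldType) (R : realType) (x y z b c : R) :
  0 <= b -> 0 <= c -> cls (x + b) = cls y -> cls (y + c) = cls z ->
  epow k c * epow k b * epow k (gap (cls x) (cls y) + gap (cls y) (cls z)) =
  epow k (b + c).
Proof.
move=> b0 c0 xy yz; apply: epow_comp => //.
by rewrite -yz; exact: cls_shift.
Qed.

Section GFunctor.
Variables (k : fieldType) (R : realType) (r s : R).
Hypotheses (r_gt0 : 0 < r) (le_rs : r <= s).
Local Notation ind := (ind r).
Local Notation Bhom := (@Bhom k R r).
Local Notation epow := (@epow k R).
Implicit Types (M N L : ind) (X Y Z : dsum ind).

Fact s_gt0 : 0 < s. Proof. exact: lt_le_trans r_gt0 le_rs. Qed.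

(* G M = E (G_fst M, G_snd M) *)
Definition G_fst M : R :=
  if pos M then pi / s * fstc M else pi / s * sndc M - pi.
Definition G_snd M : R :=
  if pos M then pi / s * sndc M + pi else pi / s * fstc M.

Lemma G_bounds M : let theta := pi - r * pi / s in
  G_fst M + theta <= G_snd M <= G_fst M + 2 * pi - theta.
Proof.
have p0 : 0 < pi / s :> R by rewrite divr_gt0 ?pi_gt0 ?s_gt0.
have := indP M; rewrite ler_norml => /andP[h1 h2].
have : 0 <= pi / s * (r - (fstc M - sndc M)) by rewrite mulr_ge0 ?(ltW p0) ?subr_ge0.
have : 0 <= pi / s * (r + (fstc M - sndc M)).
  by rewrite mulr_ge0 ?(ltW p0) //; lra.
rewrite /= (_ : r * pi / s = pi / s * r); last by rewrite -mulrA mulrC.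
rewrite /G_fst /G_snd.
move: (pi / s) (pi : R) => p P; rewrite !(mulrDr, mulrBr, opprB, mulrN) => ? ?.
by case: (pos M); apply/andP; split; lra.
Qed.

Lemma G_weak M : G_fst M <= G_snd M <= G_fst M + 2 * pi.
Proof.
have : r * pi / s <= pi.
  by rewrite ler_pdivrMr ?s_gt0 // mulrC ler_pM2l ?pi_gt0.
by have /andP[] := G_bounds M => *; apply/andP; split; lra.
Qed.

Definition G_ind M : mf k R := mfE k (G_weak M).
Definition G_ob X : mf k R := mf_dsum (fun i => G_ind (X i)).

Lemma G_in_Fc X : in_Fc (r * pi / s) (G_ob X).
Proof.
exists (rank X), (fun i => G_fst (X i)), (fun i => G_snd (X i)).
exists (fun i => G_weak (X i)); split=> [i|]; first exact: G_bounds.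
by exists (mf_id _), (mf_id _); rewrite /= !mf_comp1m.
Qed.

Definition swap2 : 'M[fps k]_2 := mx2 0 1 1 0.

(* The image under G of the basic morphism M -> N; the coefficient of e^b does
   not depend on its source and the entries of swap2 are 0 and e^0, so that the
   composition is the usual product of matrices of coefficients. *)
Definition G_basic M N : 'M[fps k]_2 :=
  swap2 ^+ (~~ pos N)
    *m mx2 (epow (pi / s * (fstc N - fstc M))) 0
           0 (epow (pi / s * (sndc N - sndc M)))
    *m swap2 ^+ (~~ pos M).

Lemma G_basicE M N :
  let u := epow (pi / s * (fstc N - fstc M)) in
  let v := epow (pi / s * (sndc N - sndc M)) in
  G_basic M N =
  if pos N then if pos M then mx2 u 0 0 v else mx2 0 u v 0
  else if pos M then mx2 0 v u 0 else mx2 v 0 0 u.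
Proof.
rewrite /G_basic; case: (pos N); case: (pos M);
  rewrite /= ?expr0 ?expr1 ?mul1mx ?mulmx1; apply: mx2P;
  by rewrite ?(mxE, big_ord_recl, big_ord0) /= ?(mxE, big_ord_recl, big_ord0) /=
     ?(mul0r, mulr0, mul1r, mulr1, addr0, add0r).
Qed.

Lemma G_basic_id M : G_basic M M = 1%:M.
Proof.
rewrite G_basicE !subrr mulr0 epow0.
by case: (pos M); apply: mx2P; rewrite !mxE.
Qed.

Ltac cls_tac :=
  solve [ apply/clsP; exists 0; lra | apply/clsP; exists 1; lra
        | apply/clsP; exists (- 1); lra ].

Lemma G_basic_comp M N L : ind_le M N -> ind_le N L ->
  Pcomp (G_ind M) (G_ind N) (G_ind L) (G_basic N L) (G_basic M N) =
  G_basic M L.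
Proof.
have p0 : 0 <= pi / s :> R by rewrite divr_ge0 ?pi_ge0 ?(ltW s_gt0).
move=> /andP[h1 h2] /andP[h3 h4]; rewrite !G_basicE.
have := (ler_wpM2l p0 h1); have := (ler_wpM2l p0 h2).
have := (ler_wpM2l p0 h3); have := (ler_wpM2l p0 h4).
rewrite /G_ind /mfE /= /G_fst /G_snd !mulrBr.
move: (_ * fstc M) (_ * sndc M) (_ * fstc N) (_ * sndc N) => x y x' y'.
move: (_ * fstc L) (_ * sndc L) => x2 y2 l1 l2 l3 l4.
case: (pos M) (pos N) (pos L) => [] [] [];
  rewrite Pcomp_dsum2 ?(mul0r, mulr0, addr0, add0r); congr mx2;
  (rewrite epow_compE; [congr epow; ring|lra|lra|cls_tac|cls_tac]).
Qed.

Lemma G_basic_hom M N : ind_le M N ->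
  Pcomp (G_ind M) (G_ind N) (G_ind N) (mf_d (G_ind N)) (G_basic M N) =
  Pcomp (G_ind M) (G_ind M) (G_ind N) (G_basic M N) (mf_d (G_ind M)).
Proof.
have p0 : 0 <= pi / s :> R by rewrite divr_ge0 ?pi_ge0 ?(ltW s_gt0).
move=> /andP[h1 h2]; rewrite !G_basicE.
have := (ler_wpM2l p0 h1); have := (ler_wpM2l p0 h2).
have /andP[] := G_weak M; have /andP[] := G_weak N.
rewrite /G_ind /mfE /= /G_fst /G_snd !mulrBr.
move: (_ * fstc M) (_ * sndc M) (_ * fstc N) (_ * sndc N) => x y x' y'.
case: (pos M) (pos N) => [] [] l1 l2 l3 l4 l5 l6;
  rewrite !Pcomp_dsum2 ?(mul0r, mulr0, addr0, add0r); congr mx2;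
  (rewrite !epow_compE; [congr epow; ring|lra|lra|cls_tac|cls_tac|lra|lra|cls_tac|cls_tac]).
Qed.

Lemma G_coord_Fs n M :
  [/\ cls (G_fst (Fs_iter s n M)) = cls (G_fst M),
      cls (G_snd (Fs_iter s n M)) = cls (G_snd M) &
      G_snd (Fs_iter s n M) - G_fst (Fs_iter s n M) = G_snd M - G_fst M].
Proof.
have H N : [/\ cls (G_fst (Fs_ind s N)) = cls (G_fst N),
    cls (G_snd (Fs_ind s N)) = cls (G_snd N) &
    G_snd (Fs_ind s N) - G_fst (Fs_ind s N) = G_snd N - G_fst N].
  have ps : pi / s * s = pi by rewrite divfK ?gt_eqF ?s_gt0.
  rewrite /G_fst /G_snd /=; case: (pos N) => /=;
    rewrite !mulrDr ps; split; try cls_tac; lra.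
elim: n => [//|m [IH1 IH2 IH3]|m [IH1 IH2 IH3]].
  by rewrite intS (addrC 1) Fs_iterS; have [-> -> ->] := H (Fs_iter s m M).
rewrite intS opprD (addrC (- 1)) Fs_iterB.
by have := H (Fs_ind_inv s (Fs_iter s (- m%:Z) M)); rewrite Fs_ind_invK IH1 IH2 IH3;
   case.
Qed.

Lemma G_ind_Fs n M : G_ind (Fs_iter s n M) = G_ind M.
Proof. by have [? ? ?] := G_coord_Fs n M; exact: eq_mfE. Qed.

(* G o F_s ^ n = G on objects and on basic morphisms *)
Lemma G_obFs n X : G_ob (Fspow_ob s n X) = G_ob X.
Proof.
rewrite /G_ob /=; congr mf_dsum.
by apply: functional_extensionality_dep => i; rewrite G_ind_Fs.
Qed.

Lemma G_basic_Fs M N : G_basic (Fs_ind s M) (Fs_ind s N) = G_basic M N.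
Proof.
have e (a b : R) : a + s - (b + s) = a - b by ring.
by rewrite !G_basicE /= !e; case: (pos N); case: (pos M).
Qed.

Lemma G_basic_Fs_iter n M N :
  G_basic (Fs_iter s n M) (Fs_iter s n N) = G_basic M N.
Proof.
elim: n => [//|m IH|m IH].
  by rewrite intS (addrC 1) !Fs_iterS G_basic_Fs.
by rewrite intS opprD (addrC (- 1)) !Fs_iterB -G_basic_Fs !Fs_ind_invK.
Qed.

Definition G_mx X Y (A : 'M[k]_(rank Y, rank X))
    : 'M[fps k]_(rank (G_ob Y), rank (G_ob X)) :=
  \mxblock_(i, j) (fpsC (A i j) *: G_basic (X j) (Y i)).

End GFunctor.

Section PcompLinear.
Variables (k : fieldType) (R : realType).
Local Notation fps := (fps k).

Lemma Pcomp_scale m n l (X : 'I_m -> circle R) (Y : 'I_n -> circle R)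
    (Z : 'I_l -> circle R) (b a : fps) (B : 'M[fps]_(l, n)) (A : 'M[fps]_(n, m)) :
  Pcomp X Y Z (b *: B) (a *: A) = (b * a) *: Pcomp X Y Z B A.
Proof.
apply/matrixP => i h; rewrite !mxE mulr_sumr; apply: eq_bigr => j _.
by rewrite !mxE; ring.
Qed.

Lemma Pcomp_suml (I : Type) (e : seq I) m n l (X : 'I_m -> circle R)
    (Y : 'I_n -> circle R) (Z : 'I_l -> circle R) (B : I -> 'M[fps]_(l, n))
    (A : 'M[fps]_(n, m)) :
  Pcomp X Y Z (\sum_(u <- e) B u) A = \sum_(u <- e) Pcomp X Y Z (B u) A.
Proof.
apply/matrixP => i h; rewrite mxE summxE.
under [RHS]eq_bigr do rewrite mxE.
rewrite exchange_big /=; apply: eq_bigr => j _.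
by rewrite summxE !mulr_suml.
Qed.

Lemma Pcomp_sumr (I : Type) (e : seq I) m n l (X : 'I_m -> circle R)
    (Y : 'I_n -> circle R) (Z : 'I_l -> circle R) (B : 'M[fps]_(l, n))
    (A : I -> 'M[fps]_(n, m)) :
  Pcomp X Y Z B (\sum_(u <- e) A u) = \sum_(u <- e) Pcomp X Y Z B (A u).
Proof.
apply/matrixP => i h; rewrite mxE summxE.
under [RHS]eq_bigr do rewrite mxE.
rewrite exchange_big /=; apply: eq_bigr => j _.
by rewrite summxE mulr_sumr mulr_suml.
Qed.

(* congruence modulo t ^ (d + 1) *)
Definition eqt d (a b : fps) := forall i, (i <= d)%N -> coefs a i = coefs b i.
Definition eqtm d m n (A B : 'M[fps]_(m, n)) := forall i j, eqt d (A i j) (B i j).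

Lemma eqt_mul d (a a' b b' : fps) :
  eqt d a a' -> eqt d b b' -> eqt d (a * b) (a' * b').
Proof.
move=> ea eb i id; rewrite !coefsM; apply: eq_bigr => -[j hj] _ /=.
by rewrite ea ?eb //; lia.
Qed.

Lemma eqt_sum d (I : Type) (e : seq I) (F F' : I -> fps) :
  (forall i, eqt d (F i) (F' i)) -> eqt d (\sum_(i <- e) F i) (\sum_(i <- e) F' i).
Proof. by move=> h i id; rewrite !coefs_sum; apply: eq_bigr => j _; exact: h. Qed.

Lemma eqtm_sum d (I : Type) (e : seq I) m n (F F' : I -> 'M[fps]_(m, n)) :
  (forall i, eqtm d (F i) (F' i)) ->
  eqtm d (\sum_(i <- e) F i) (\sum_(i <- e) F' i).
Proof. by move=> h i j; rewrite !summxE; apply: eqt_sum => l; exact: h. Qed.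

Lemma eqtm_Pcomp d m n l (X : 'I_m -> circle R) (Y : 'I_n -> circle R)
    (Z : 'I_l -> circle R) (B B' : 'M[fps]_(l, n)) (A A' : 'M[fps]_(n, m)) :
  eqtm d B B' -> eqtm d A A' -> eqtm d (Pcomp X Y Z B A) (Pcomp X Y Z B' A').
Proof.
move=> eB eA i h; rewrite !mxE; apply: eqt_sum => j.
by apply: eqt_mul; [apply: eqt_mul; [exact: eB|exact: eA]|move=> ? _].
Qed.

Lemma eqtm_eq m n (A B : 'M[fps]_(m, n)) : (forall d, eqtm d A B) -> A = B.
Proof. by move=> h; apply/matrixP => i j; apply: fpsP => d; exact: (h d). Qed.

Lemma eqtm_trans d m n (A B C : 'M[fps]_(m, n)) :
  eqtm d A B -> eqtm d B C -> eqtm d A C.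
Proof. by move=> h h' i j l ld; rewrite h // h'. Qed.

Lemma eqtm_sym d m n (A B : 'M[fps]_(m, n)) : eqtm d A B -> eqtm d B A.
Proof. by move=> h i j l ld; rewrite h. Qed.

End PcompLinear.

Section GhatFunctor.
Variables (k : fieldType) (R : realType) (r s : R).
Hypotheses (r_gt0 : 0 < r) (le_rs : r <= s).
Local Notation ind := (ind r).
Local Notation Bhom := (@Bhom k R r).
Local Notation epow := (@epow k R).
Local Notation G_ob := (G_ob k r_gt0 le_rs).
Local Notation G_ind := (G_ind k r_gt0 le_rs).
Local Notation G_basic := (G_basic k s).
Local Notation Gmx := (G_mx r_gt0 le_rs).
Local Notation orbit_hom := (orbit_hom k s).
Local Notation Fspow_ob := (Fspow_ob s).
Implicit Types (M N L : ind) (X Y Z : dsum ind).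

Fact G_hom_subproof X Y (f : Bhom X Y) :
  @is_mf_hom k R (G_ob X) (G_ob Y) (Gmx (val f)).
Proof.
apply/eqP; rewrite /Gmx /=.
rewrite (@Pcomp_mxdiagl k R _ _ (fun i => G_ind (Y i)) (fun i => G_ind (X i))
  (fun i => mf_d (G_ind (Y i)))).
rewrite (@Pcomp_mxdiagr k R _ _ (fun i => G_ind (Y i)) (fun i => G_ind (X i))
  (fun i => mf_d (G_ind (X i)))).
apply: eq_mxblock => i j.
have /is_BhomP h := valP f.
have [le|/h ->] := boolP (ind_le (X j) (Y i)); last first.
  by rewrite fpsC0 !scale0r Pcomp0m Pcompm0.
rewrite -[mf_d (G_ind (Y i))]scale1r -[mf_d (G_ind (X j))]scale1r.
by rewrite !Pcomp_scale G_basic_hom // mulrC.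
Qed.
Definition G_hom X Y (f : Bhom X Y) : mf_hom (G_ob X) (G_ob Y) :=
  Sub _ (G_hom_subproof f).

Lemma Pcomp_G_mx X Y Z (g : Bhom Y Z) (f : Bhom X Y) :
  Pcomp (G_ob X) (G_ob Y) (G_ob Z) (Gmx (val g)) (Gmx (val f)) =
  Gmx (val g *m val f).
Proof.
rewrite /Gmx (@Pcomp_mxblock k R _ _ _ (fun i => G_ind (X i))
  (fun i => G_ind (Y i)) (fun i => G_ind (Z i))).
apply: eq_mxblock => i h; rewrite mxE fpsC_sum scaler_suml.
apply: eq_bigr => j _; rewrite Pcomp_scale fpsCM.
have /is_BhomP hf := valP f; have /is_BhomP hg := valP g.
have [le1|/hf ->] := boolP (ind_le (X h) (Y j)); last first.
  by rewrite fpsC0 mulr0 !scale0r.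
have [le2|/hg ->] := boolP (ind_le (Y j) (Z i)); last first.
  by rewrite fpsC0 mul0r !scale0r.
by rewrite G_basic_comp.
Qed.

Lemma G_mx1 X : Gmx (1%:M : 'M[k]_(rank X)) = 1%:M.
Proof.
rewrite /Gmx -[RHS]mxdiagZ /mxdiag; apply: eq_mxblock => i j.
rewrite mxE; case: eqP => [->|_]; last by rewrite fpsC0 scale0r.
by rewrite conform_mx_id fpsC1 scale1r G_basic_id.
Qed.

Definition G : functor (Bcat k r) (Fc k (r * pi / s)).
refine (@Functor (Bcat k r) (Fc k (r * pi / s))
  (fun X => exist _ (G_ob X) (G_in_Fc k r_gt0 le_rs X)) G_hom _ _).
- by move=> X; apply: val_inj; exact: G_mx1.
- by move=> X Y Z g f; apply: val_inj; rewrite /= Pcomp_G_mx.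
Defined.

(* The t-adic sum of a family of power series in which each coefficient vanishes
   for all but finitely many indices (see Ghat_bound for the family below). *)
Definition tsum (u : int -> fps k) : fps k :=
  Fps (fun m => \sum_(n \in [set: int]) coefs (u n) m).

(* G (F ^ n Y) = G Y by G_obFs; in particular the ranks agree. *)
Definition Ghat_mx X Y (f : orbit_hom X Y)
    : 'M[fps k]_(rank (G_ob Y), rank (G_ob X)) :=
  \matrix_(i, j) tsum (fun n =>
    (val (G_hom (f n)) : 'M[fps k]_(rank (G_ob Y), rank (G_ob X))) i j).

Let Gn X Y (f : orbit_hom X Y) n : 'M[fps k]_(rank (G_ob Y), rank (G_ob X)) :=
  val (G_hom (f n)).

Lemma G_basic_coefs M N n a b d :
  coefs (G_basic M (Fs_iter s n N) a b) d != 0 ->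
  s * n%:~R <= `|fstc M| + `|sndc M| + `|fstc N| + `|sndc N| + r + 2 * s * d.+1%:R.
Proof.
have s0 := s_gt0 r_gt0 le_rs.
have p0 : 0 < pi / s :> R by rewrite divr_gt0 ?pi_gt0.
pose N' := Fs_iter s n N.
have key (u : R) : coefs (epow (pi / s * u)) d != 0 -> u < 2 * s * d.+1%:R.
  apply: contraNT; rewrite -leNgt => hu; rewrite /epow coefsXn.
  suff : (d < Num.truncn (pi / s * u / (2 * pi)))%N.
    by move=> hd; rewrite ltn_eqF.
  rewrite truncn_gt_nat ler_pdivlMr ?pi2_gt0 //.
  rewrite (_ : _ * (2 * pi) = pi / s * (2 * s * d.+1%:R)).
    by rewrite ler_pM2l.
  by field; rewrite gt_eqF.
have hs := Fs_iter_sum s n N; have := indP N'; rewrite ler_norml => /andP[l1 l2].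
have h1 := ler_norm (fstc M); have h2 := ler_norm (sndc M).
have h3 := ler_norm (- fstc N); have h4 := ler_norm (- sndc N).
rewrite !normrN in h3 h4.
have q1 := normr_ge0 (fstc M); have q2 := normr_ge0 (sndc M).
have q3 := normr_ge0 (fstc N); have q4 := normr_ge0 (sndc N).
rewrite -/N' in hs *.
have fin u : u = fstc N' - fstc M \/ u = sndc N' - sndc M ->
  coefs (epow (pi / s * u)) d != 0 ->
  s * n%:~R <= `|fstc M| + `|sndc M| + `|fstc N| + `|sndc N| + r + 2 * s * d.+1%:R.
  by move=> hu /key; case: hu => ->; lra.
have z : coefs (0 : fps k) d != 0 = false by rewrite coefs0 eqxx.
rewrite G_basicE; case: (pos N'); case: (pos M); rewrite mxE;
  case: (a == 0); case: (b == 0); rewrite ?z //; apply: fin; tauto.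
Qed.

Lemma Gn_coefs X Y (f : orbit_hom X Y) n i j d :
  coefs (Gn f n i j) d != 0 ->
  coefs (G_basic (X (tagnat.sig1 j)) (Fs_iter s n (Y (tagnat.sig1 i)))
    (tagnat.sig2 i) (tagnat.sig2 j)) d != 0 /\ val (f n) != 0.
Proof.
rewrite /Gn /= /Gmx !mxE coefsCM mulf_eq0 negb_or => /andP[nz ->]; split=> //.
by apply: contraNneq nz => ->; rewrite mxE.
Qed.

(* t-adic convergence: modulo t ^ (d + 1), only finitely many terms contribute;
   see also Ghat_eqt. *)
Lemma Ghat_bound X Y (f : orbit_hom X Y) d : exists K : nat,
  (forall n, val (f n) != 0 -> - K%:Z <= n) /\
  (forall n i j d', (d' <= d)%N -> coefs (Gn f n i j) d' != 0 -> n <= K%:Z).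
Proof.
have s0 := s_gt0 r_gt0 le_rs.
have [a ha] := orbit_bound k s0 X Y.
pose v M N := `|fstc M| + `|sndc M| + `|fstc N| + `|sndc N| + r + 2 * s * d.+1%:R.
pose b := \max_(i < rank Y) \max_(j < rank X) Num.bound (v (X j) (Y i) / s).
exists (maxn `|a| b); split=> [n /ha|n i j d' dd /Gn_coefs[/G_basic_coefs hn _]].
  by lia.
set i' := tagnat.sig1 i in hn; set j' := tagnat.sig1 j in hn.
have hb : (Num.bound (v (X j') (Y i') / s) <= b)%N.
  rewrite /b; apply: leq_trans (leq_bigmax i'); exact: (leq_bigmax j').
have : n%:~R <= b%:Z%:~R :> R.
  apply: le_trans (_ : v (X j') (Y i') / s <= _).
    rewrite ler_pdivlMr // mulrC; apply: le_trans hn _.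
    by rewrite lerD2l ler_pM2l ?mulr_gt0 // ler_nat.
  apply: le_trans (ler_norm _) _; apply/ltW/(lt_le_trans (truncnS_gt _)).
  by rewrite ler_nat.
by rewrite ler_int; lia.
Qed.

Let sym (K : nat) : seq int := intvl (- K%:Z) K%:Z.

Lemma Ghat_eqt X Y (f : orbit_hom X Y) d (e : seq int) : uniq e ->
  (forall n i j d', (d' <= d)%N -> coefs (Gn f n i j) d' != 0 -> n \in e) ->
  eqtm d (Ghat_mx f) (\sum_(n <- e) Gn f n).
Proof.
move=> ue he i j d' dd; rewrite mxE summxE coefs_sum /=.
by apply: fsum_seq => // n; exact: he.
Qed.

Lemma summand_G_Fs n Y :
  @summand _ (G_ob (Fspow_ob n Y)) = @summand _ (G_ob Y)
    :> ('I_(rank (G_ob Y)) -> circle R).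
Proof.
apply/funext => j /=.
by have [-> -> _] := G_coord_Fs r_gt0 le_rs n (Y (tagnat.sig1 j)).
Qed.

Lemma is_mf_hom_Fs n X Y (A : 'M[fps k]_(rank (G_ob Y), rank (G_ob X))) :
  @is_mf_hom k R (G_ob X) (G_ob (Fspow_ob n Y)) A = @is_mf_hom k R (G_ob X) (G_ob Y) A.
Proof.
have ed : mf_d (G_ob (Fspow_ob n Y)) = mf_d (G_ob Y)
    :> 'M[fps k]_(rank (G_ob Y)).
  apply: eq_mxdiag => i /=.
  have [_ _ e] := G_coord_Fs r_gt0 le_rs n (Y i).
  have c (x y : R) : x + 2 * pi - y = 2 * pi - (y - x) by ring.
  by rewrite !c e.
by rewrite /is_mf_hom summand_G_Fs ed.
Qed.

Fact Ghat_subproof X Y (f : orbit_hom X Y) :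
  @is_mf_hom k R (G_ob X) (G_ob Y) (Ghat_mx f).
Proof.
apply/eqP/eqtm_eq => d; have [K [hK1 hK2]] := Ghat_bound f d.
have hF : eqtm d (Ghat_mx f) (\sum_(n <- sym K) Gn f n).
  apply: Ghat_eqt; first exact: intvl_uniq.
  move=> n i j d' dd nz; apply: mem_intvl.
  by have [_ /hK1 ->] := Gn_coefs nz; rewrite (hK2 _ _ _ _ dd nz).
apply: (@eqtm_trans _ d _ _ _
  (Pcomp (G_ob X) (G_ob Y) (G_ob Y) (mf_d (G_ob Y)) (\sum_(n <- sym K) Gn f n))).
  exact: eqtm_Pcomp.
apply: eqtm_sym; apply: (@eqtm_trans _ d _ _ _
  (Pcomp (G_ob X) (G_ob X) (G_ob Y) (\sum_(n <- sym K) Gn f n) (mf_d (G_ob X)))).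
  exact: eqtm_Pcomp.
rewrite Pcomp_suml Pcomp_sumr; apply: eqtm_sum => n.
by have := valP (G_hom (f n)); rewrite is_mf_hom_Fs => /eqP <-.
Qed.
Definition Ghat_hom X Y (f : orbit_hom X Y) : mf_hom (G_ob X) (G_ob Y) :=
  Sub _ (Ghat_subproof f).

Lemma Ghat_id X : Ghat_mx (orbit_id k s X) = 1%:M.
Proof.
apply: eqtm_eq => d; apply: (@eqtm_trans _ d _ _ _
  (\sum_(n <- [:: 0 : int]) Gn (orbit_id k s X) n)).
  apply: Ghat_eqt => // n i j d' _ /Gn_coefs[_] /=.
  by rewrite inE; case: (n == 0) => //; rewrite eqxx.
by rewrite big_seq1 /Gn /= -G_mx1.
Qed.

Lemma G_mx_Fs n X Y (A : 'M[k]_(rank Y, rank X)) :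
  @G_mx k R r s r_gt0 le_rs (Fspow_ob n X) (Fspow_ob n Y) A = Gmx A
    :> 'M[fps k]_(rank (G_ob Y), rank (G_ob X)).
Proof. by apply: eq_mxblock => i j /=; rewrite G_basic_Fs_iter. Qed.

Lemma G_mx_sum X Y (I : Type) (e : seq I) (A : I -> 'M[k]_(rank Y, rank X)) :
  Gmx (\sum_(i <- e) A i) = \sum_(i <- e) Gmx (A i).
Proof.
apply/matrixP => i j; rewrite summxE !mxE summxE fpsC_sum mulr_suml.
by apply: eq_bigr => l _; rewrite !mxE.
Qed.

Lemma Gn_comp X Y Z (g : orbit_hom Y Z) (f : orbit_hom X Y) n (e : seq int) :
  uniq e -> (forall l, val (g (n - l)) != 0 -> val (f l) != 0 -> l \in e) ->
  Gn (orbit_comp g f) n =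
  \sum_(l <- e) Pcomp (G_ob X) (G_ob Y) (G_ob Z) (Gn g (n - l)) (Gn f l).
Proof.
move=> ue he; rewrite /Gn /= /orbit_comp_mx (fsum_seq ue); last first.
  move=> l nz; apply: he; apply: contraNneq nz => /= ->.
    by rewrite mul0mx.
  by rewrite mulmx0.
rewrite (@G_mx_sum X (Fspow_ob n Z)); apply: eq_bigr => l _.
have -> : G_mx r_gt0 le_rs (X := X) (Y := Fspow_ob n Z)
      (val (Bcomp (Fspow_hom s l (g (n - l))) (f l))) =
    G_mx r_gt0 le_rs (X := X) (Y := Fspow_ob l (Fspow_ob (n - l) Z))
      (val (Bcomp (Fspow_hom s l (g (n - l))) (f l)))
    :> 'M[fps k]_(rank (G_ob Z), rank (G_ob X)).
  by apply: eq_mxblock => i j /=; rewrite -Fs_iterD [l + _]addrC subrK.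
rewrite -(Pcomp_G_mx (Fspow_hom s l (g (n - l))) (f l)).
by rewrite !summand_G_Fs (@G_mx_Fs l Y (Fspow_ob (n - l) Z)).
Qed.

Lemma Ghat_comp X Y Z (g : orbit_hom Y Z) (f : orbit_hom X Y) :
  Ghat_mx (orbit_comp g f) =
  Pcomp (G_ob X) (G_ob Y) (G_ob Z) (Ghat_mx g) (Ghat_mx f).
Proof.
apply: eqtm_eq => d.
have [K1 [hf1 hf2]] := Ghat_bound f d; have [K2 [hg1 hg2]] := Ghat_bound g d.
have [K3 [hh1 hh2]] := Ghat_bound (orbit_comp g f) d.
pose e3 := sym (K1 + K2 + K3); pose e4 := sym (K1 + K2 + K2 + K3).
have e3P n : n \in e3 -> n <= (K1 + K2 + K3)%N%:Z.
  by move=> /mapP[i]; rewrite mem_iota => hi ->; lia.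
apply: (@eqtm_trans _ d _ _ _ (\sum_(n <- e3) Gn (orbit_comp g f) n)).
  apply: Ghat_eqt => [|n i j d' dd nz]; first exact: intvl_uniq.
  have [_ /hh1 ?] := Gn_coefs nz; have := hh2 _ _ _ _ dd nz => ?.
  by apply: mem_intvl; lia.
have hF : eqtm d (Ghat_mx f) (\sum_(n <- e4) Gn f n).
  apply: Ghat_eqt => [|n i j d' dd nz]; first exact: intvl_uniq.
  have [_ /hf1 ?] := Gn_coefs nz; have := hf2 _ _ _ _ dd nz => ?.
  by apply: mem_intvl; lia.
apply: eqtm_sym; apply: (@eqtm_trans _ d _ _ _
  (Pcomp (G_ob X) (G_ob Y) (G_ob Z) (Ghat_mx g) (\sum_(n <- e4) Gn f n))).
  exact: eqtm_Pcomp.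
rewrite Pcomp_sumr.
have -> : \sum_(n <- e3) Gn (orbit_comp g f) n = \sum_(l <- e4) \sum_(n <- e3)
    Pcomp (G_ob X) (G_ob Y) (G_ob Z) (Gn g (n - l)) (Gn f l).
  rewrite exchange_big; apply: eq_big_seq => n /e3P hn /=.
  apply: Gn_comp; first exact: intvl_uniq.
  by move=> l /hg1 ? /hf1 ?; apply: mem_intvl; lia.
apply: eqtm_sum => l; rewrite -Pcomp_suml.
have [fl|nfl] := pselect (- K1%:Z <= l <= K1%:Z).
  apply: eqtm_Pcomp => //.
  have -> : \sum_(n <- e3) Gn g (n - l) = \sum_(n <- [seq n - l | n <- e3]) Gn g n.
    by rewrite [RHS]big_map.
  apply: Ghat_eqt => [|n i j d' dd nz].
    by rewrite map_inj_uniq ?intvl_uniq // => x y /addIr.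
  have [_ /hg1 ?] := Gn_coefs nz; have := hg2 _ _ _ _ dd nz => ?.
  by apply/mapP; exists (n + l); [apply: mem_intvl; lia|rewrite addrK].
have f0 : eqtm d (Gn f l) 0.
  move=> i j d' dd; rewrite [in RHS]mxE [in RHS]coefs0; apply/eqP.
  apply: contra_notT nfl => nz; have [_ /hf1 ->] := Gn_coefs nz.
  exact: hf2 dd nz.
apply: (@eqtm_trans _ d _ _ _ 0).
  by rewrite -(@Pcompm0 k R (G_ob X) (G_ob Y) (G_ob Z) (Ghat_mx g)); exact: eqtm_Pcomp.
apply: eqtm_sym.
by rewrite -(@Pcompm0 k R (G_ob X) (G_ob Y) (G_ob Z) (\sum_(n <- e3) Gn g (n - l)));
   exact: eqtm_Pcomp.
Qed.

Definition Ghat : functor (orbit_cat k r (s_gt0 r_gt0 le_rs)) (Fc k (r * pi / s)).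
refine (@Functor (orbit_cat k r (s_gt0 r_gt0 le_rs)) (Fc k (r * pi / s))
  (fun X => G X) Ghat_hom _ _).
- by move=> X; apply: val_inj; exact: Ghat_id.
- by move=> X Y Z g f; apply: val_inj; exact: Ghat_comp.
Defined.

End GhatFunctor.

(* Main.v *)
(* On homomorphisms, a 2 x 2 block B : E(x, y) -> E(x', y') commuting with d is
   determined by the coefficients in one of its rows or columns: the other two
   entries carry the same coefficients with shifted exponents, and a coefficient
   has to vanish when the shifted exponent is negative. The pairs (entry of a
   fixed parity, power of t) are in bijection with the integers n, through the
   exponent of e in G applied to the basic morphism M -> F_s^n N, and the two
   exponents at n are both nonnegative exactly when this basic morphism exists.
   On objects, M(s x / pi, s (y - pi) / pi)_+ is sent to E(x, y). *)
Require Import Defs.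
From mathcomp Require Import all_boot all_order all_algebra.
From mathcomp Require Import boolp reals trigo.
From mathcomp Require Import ring lra zify.
Import Defs.
Set Implicit Arguments.
Unset Strict Implicit.
Unset Printing Implicit Defensive.
Import Order.TTheory GRing.Theory Num.Theory.
Local Open Scope ring_scope.

(** * Fully faithful and essentially surjective functors *)

(** Choice yields preimages [H0 Z] with isomorphisms to [Z]; the quasi-inverse conjugates by these
    and lifts through fullness, and faithfulness reflects the functor laws and naturality. *)
Lemma is_equivalence_ff (C D : category) (F : functor C D) :
    (forall (X Y : C) (g : hom (F X) (F Y)), exists f : hom X Y, fhom F f = g) ->
    (forall (X Y : C) (f f' : hom X Y), fhom F f = fhom F f' -> f = f') ->
    (forall Z : D, exists X : C, isom (F X) Z) ->
  is_equivalence F.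
Proof.
move=> full faith ess.
pose H0 Z := projT1 (cid (ess Z)).
have iso Z : {u : hom (F (H0 Z)) Z & {v : hom Z (F (H0 Z)) |
    compm v u = idm _ /\ compm u v = idm _}}.
  by have /cid[u /cid v] := projT2 (cid (ess Z)); exists u; exact: v.
pose u Z := projT1 (iso Z).
pose v Z := sval (projT2 (iso Z)).
have vu Z : compm (v Z) (u Z) = idm _ by rewrite /v; case: (projT2 (iso Z)) => ? [].
have uv Z : compm (u Z) (v Z) = idm _ by rewrite /v; case: (projT2 (iso Z)) => ? [].
pose pre X Y (g : hom (F X) (F Y)) := projT1 (cid (full X Y g)).
have preK X Y (g : hom (F X) (F Y)) : fhom F (pre X Y g) = g.
  exact: projT2 (cid (full X Y g)).
pose H1 Z W (f : hom Z W) := pre _ _ (compm (v W) (compm f (u Z))).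
have H11 Z : H1 Z Z (idm Z) = idm _.
  by apply: faith; rewrite preK comp1m vu fhom1.
have H1M X Y Z (g : hom Y Z) (f : hom X Y) :
    H1 _ _ (compm g f) = compm (H1 _ _ g) (H1 _ _ f).
  apply: faith; rewrite fhomM !preK -!compmA; congr (compm _ (compm _ _)).
  by rewrite (compmA (u Y)) uv comp1m.
exists (Functor H11 H1M); split.
  exists (fun X => pre _ _ (u (F X))), (fun X => pre _ _ (v (F X))).
  split=> [X|X|X Y f] /=; apply: faith; rewrite !fhomM !preK ?vu ?uv ?fhom1 //.
  by rewrite compmA uv comp1m.
exists u, v; split=> // X Y f /=.
by rewrite preK compmA uv comp1m.
Qed.

(** * Powers of [t] and winding numbers on the circle *)

Lemma coefs_XnM (k : fieldType) (i : nat) (a : fps k) n :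
  coefs (fpsX k ^+ i * a) n = if (i <= n)%N then coefs a (n - i) else 0.
Proof.
rewrite coefsM; under eq_bigr do rewrite coefsXn.
case: leqP => [le_in|lt_ni].
  rewrite (bigD1 (inord i)) //= inordK ?ltnS // eqxx mul1r big1 ?addr0 //.
  move=> j ne_ji; case: eqP => [ji|_]; last by rewrite mul0r.
  by case/eqP: ne_ji; apply: val_inj; rewrite /= inordK ?ltnS.
rewrite big1 // => j _; case: eqP => [ji|_]; last by rewrite mul0r.
by have := ltn_ord j; rewrite ji ltnS leqNgt lt_ni.
Qed.

Lemma gap_neg (R : realType) (p q : circle R) (m : nat) :
  gap p q + 2 * pi * (Negz m)%:~R < 0.
Proof.
have := gap_lt p q.
have : 2 * pi <= 2 * pi * m.+1%:R :> R.
  by rewrite ler_peMr ?(ltW (pi2_gt0 R)) ?ler1n.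
by rewrite NegzE intrN -pmulrn; lra.
Qed.

(** Following the shortest path from [p] to [[y]] by [e^c] winds [i] times more than the shortest
    path to [u], which is the power of [t] that appears. The relation between lengths is kept for
    comparison with other paths. *)
Lemma gap_then_epow (k : fieldType) (R : realType) (p u : circle R) (y c : R) :
    0 <= c -> cls (y + c) = u ->
  exists2 i : nat, gap p (cls y) + c = gap p u + 2 * pi * i%:R &
    epow k c * epow k (gap p (cls y) + gap (cls y) u) = fpsX k ^+ i.
Proof.
move=> c0 yc; pose x := repr p; have xp : cls x = p by exact: cls_repr.
have xy : cls (x + gap p (cls y)) = cls y by rewrite -xp cls_gap.
have xu : cls (x + gap p (cls y) + c) = u by rewrite (cls_shift c xy).
have g0 := gap_ge0 p (cls y).
have [i iE] : exists i : nat, gap p (cls y) + c = gap p u + 2 * pi * i%:R.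
  by rewrite -[in gap p u]xp; apply: gapP; rewrite ?addr_ge0 // addrA.
exists i => //.
by have := epow_comp k g0 c0 xy xu; rewrite iE xp epow_gap mulr1 epow_gapD.
Qed.

Lemma epow_then_gap (k : fieldType) (R : realType) (q u : circle R) (x c : R) :
    0 <= c -> cls (x + c) = q ->
  exists2 j : nat, c + gap q u = gap (cls x) u + 2 * pi * j%:R &
    epow k c * epow k (gap (cls x) q + gap q u) = fpsX k ^+ j.
Proof.
move=> c0 xq; have xu : cls (x + c + gap q u) = u by rewrite -xq cls_gap.
have g0 := gap_ge0 q u.
have [j jE] : exists j : nat, c + gap q u = gap (cls x) u + 2 * pi * j%:R.
  by apply: gapP; rewrite ?addr_ge0 // addrA.
exists j => //.
by have := epow_comp k c0 g0 xq xu; rewrite jE epow_gap mul1r epow_gapD.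
Qed.

(** * Entries of [G] and of the differentials in coordinates *)

Section Coordinates.
Variables (k : fieldType) (R : realType) (r s : R).
Hypotheses (r_gt0 : 0 < r) (le_rs : r <= s).
Implicit Types (M N : ind r) (a b : 'I_2).
Local Notation G_ind := (G_ind k r_gt0 le_rs).
Local Notation G_basic := (G_basic k s).
Local Notation point M a := (@summand _ (mf_ob (G_ind M)) a).

Let s_gt0 : 0 < s := s_gt0 r_gt0 le_rs.
Let pi_s_gt0 : 0 < pi / s :> R. Proof. by rewrite divr_gt0 ?pi_gt0. Qed.

(* The basis vector of G M with index a comes from the first coordinate of M;
   the sign of M decides which of the two indices this is. *)
Definition is_fst M a : bool := (a == 0) == pos M.
Definition coord M a : R := if is_fst M a then fstc M else sndc M.

Lemma ord2P a : a = 0 \/ a = 1.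
Proof. by case: a => [[|[|a]] h] //; [left|right]; apply: val_inj. Qed.

Lemma is_fst_inj M a b : is_fst M a = is_fst M b -> a = b.
Proof.
by rewrite /is_fst; case: (ord2P a) (ord2P b) => -> [] ->; case: (pos M).
Qed.

Lemma is_fst_neq M a a' : a' != a -> is_fst M a' = ~~ is_fst M a.
Proof.
by rewrite /is_fst; case: (ord2P a) (ord2P a') => -> [] ->; case: (pos M).
Qed.

Lemma is_fst_Fs n M a : is_fst (Fs_iter s n M) a = is_fst M a (+) odd `|n|%N.
Proof.
have step N : is_fst (Fs_ind s N) a = ~~ is_fst N a.
  by rewrite /is_fst /=; case: (a == 0); case: (pos N).
elim: n => [|m IH|m IH]; first by rewrite addbF.
  by rewrite intS (addrC 1) Fs_iterS step IH addrC /= addbN.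
rewrite intS opprD (addrC (- 1)) Fs_iterB.
apply: negb_inj; rewrite -step Fs_ind_invK IH -addbN -oddS; congr (_ (+) _).
by rewrite -opprD !abszN; lia.
Qed.

(* Passing from M to F_s M exchanges the two coordinates and the two signs, so
   that at a fixed index only the translation by s remains. *)
Lemma coord_Fs n M a : coord (Fs_iter s n M) a = coord M a + s * n%:~R.
Proof.
have step N : coord (Fs_ind s N) a = coord N a + s.
  by rewrite /coord /is_fst /=; case: (a == 0); case: (pos N).
elim: n => [|m IH|m IH]; first by rewrite mulr0 addr0.
  by rewrite intS (addrC 1) Fs_iterS step IH intrD mulrDr; lra.
rewrite intS opprD (addrC (- 1)) Fs_iterB.
have := step (Fs_ind_inv s (Fs_iter s (- m%:Z) M)).
by rewrite Fs_ind_invK IH intrB mulrBr; lra.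
Qed.

(** For indices coming from the same coordinate, this is the exponent of [e] in that entry of [G] on
    basic morphisms. Mixed indices occur in the differential, where half a turn is added. *)
Definition basic_exp M N a b : R := pi / s * (coord N a - coord M b).

Lemma G_basic_entry M N a b :
  G_basic M N a b =
  if is_fst M b == is_fst N a then epow k (basic_exp M N a b) else 0.
Proof.
rewrite G_basicE /basic_exp /coord /is_fst.
by case: (ord2P a) (ord2P b) => -> [] ->; case: (pos M); case: (pos N);
   rewrite mxE.
Qed.

Lemma summand_G_ind M a :
  point M a = cls (pi / s * coord M a + pi * (~~ is_fst M a)%:R).
Proof.
rewrite /coord /is_fst /= /G_fst /G_snd; case: (ord2P a) => ->;
  case: (pos M) => /=; rewrite ?mulr0 ?addr0 ?mulr1 //.
by rewrite -cls_periodD; congr cls; ring.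
Qed.

Lemma mf_d_G_ind M a b : mf_d (G_ind M) a b =
  if a == b then 0 else epow k (basic_exp M M a b + pi).
Proof.
rewrite /basic_exp /coord /is_fst /= /G_fst /G_snd.
by case: (ord2P a) (ord2P b) => -> [] ->; case: (pos M); rewrite mxE //=;
   congr epow; ring.
Qed.

Lemma mf_d_exp_ge0 M a b : 0 <= basic_exp M M a b + pi.
Proof.
have /andP[] := G_weak r_gt0 le_rs M.
rewrite /basic_exp /coord /is_fst /G_fst /G_snd !mulrBr; have := pi_gt0 R.
by case: (ord2P a) (ord2P b) => -> [] ->; case: (pos M) => /=; lra.
Qed.

Lemma cls_mf_d M a a' : a' != a ->
  cls (pi / s * coord M a + pi * (~~ is_fst M a)%:R + (basic_exp M M a' a + pi)) =
  point M a'.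
Proof.
move=> na; rewrite summand_G_ind (is_fst_neq M na) /basic_exp.
case: (is_fst M a) => /=.
  by congr cls; ring.
by rewrite -[RHS]cls_periodD; congr cls; ring.
Qed.

Local Notation gapG M N b a := (gap (point M b) (point N a)).

Lemma basic_exp_Fs M N n a b :
  basic_exp M (Fs_iter s n N) a b = basic_exp M N a b + pi * n%:~R.
Proof. by rewrite /basic_exp coord_Fs; field; rewrite gt_eqF. Qed.

(** Since [G] sends [F_s^n N] and [N] to the same object, the exponent of a matching entry and the
    gap join the same two points of the circle. *)
Lemma exp_gapz M N n a b : is_fst M b == is_fst (Fs_iter s n N) a ->
  exists z : int,
    basic_exp M (Fs_iter s n N) a b = gapG M N b a + 2 * pi * z%:~R.
Proof.
move=> mt.
have := cls_gap (pi / s * coord M b + pi * (~~ is_fst M b)%:R) (point N a).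
have -> : point N a = point (Fs_iter s n N) a.
  by rewrite /=; have [-> -> _] := G_coord_Fs r_gt0 le_rs n N.
rewrite [in RHS]summand_G_ind -(eqP mt) -summand_G_ind => /esym/clsP[z hz].
exists z; rewrite /basic_exp; lra.
Qed.

Lemma exp_gap_ex M N a b (m : nat) : exists n,
  is_fst M b == is_fst (Fs_iter s n N) a /\
  basic_exp M (Fs_iter s n N) a b = gapG M N b a + 2 * pi * m%:R.
Proof.
have /clsP[z hz] :
    cls (pi / s * coord M b + pi * (~~ is_fst M b)%:R + gapG M N b a) =
    cls (pi / s * coord N a + pi * (~~ is_fst N a)%:R).
  by rewrite -summand_G_ind [X in gap X _]summand_G_ind cls_gap.
(* The difference of the two bits gives [n] the required parity and accounts for half turns; [z] and
   [m] count whole turns. *)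
exists ((~~ is_fst N a)%:Z - (~~ is_fst M b)%:Z + 2 * (z + m%:Z)); split.
  rewrite is_fst_Fs; apply/eqP; case: (is_fst M b) (is_fst N a) => [] []; lia.
rewrite basic_exp_Fs /basic_exp intrD intrB intrM intrD.
move: hz; rewrite -!pmulrn; lra.
Qed.

Lemma basic_exp_inj M N n n' a b :
  basic_exp M (Fs_iter s n N) a b = basic_exp M (Fs_iter s n' N) a b -> n = n'.
Proof.
rewrite !basic_exp_Fs => /addrI/(mulfI (lt0r_neq0 (pi_gt0 R)))/eqP.
by rewrite eqr_int => /eqP.
Qed.

Lemma basic_exp_ge0 M N a b : is_fst M b == is_fst N a -> ind_le M N ->
  0 <= basic_exp M N a b.
Proof.
move=> /eqP e /andP[h1 h2]; rewrite /basic_exp pmulr_rge0 // subr_ge0 /coord e.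
by case: ifP.
Qed.

(** The pair [(a, b)] compares one coordinate of [M] and [N], the complementary pair the other
    one. *)
Lemma ind_le_basic_exp M N a b a' b' : is_fst M b == is_fst N a ->
  a' != a -> b' != b ->
  ind_le M N = (0 <= basic_exp M N a b) && (0 <= basic_exp M N a' b').
Proof.
move=> /eqP e na nb; rewrite /basic_exp !pmulr_rge0 // !subr_ge0 /coord.
rewrite (is_fst_neq N na) (is_fst_neq M nb) e /ind_le.
by case: (is_fst N a) => //=; rewrite andbC.
Qed.

Lemma exp_gap_nat M N n a b :
    is_fst M b == is_fst (Fs_iter s n N) a ->
    0 <= basic_exp M (Fs_iter s n N) a b ->
  exists m : nat,
    basic_exp M (Fs_iter s n N) a b = gapG M N b a + 2 * pi * m%:R.
Proof.
move=> /exp_gapz[[m|m] ->]; first by exists m.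
by rewrite leNgt gap_neg.
Qed.

(** The differentials have zero diagonal, so each side of the commutation relation reduces, at a
    given place, to one entry of [B] times a power of [t]. *)
Lemma comm_coefs M N (B : 'M[fps k]_2) a b a' b' (m : nat) (z : int) :
    Pcomp (G_ind M) (G_ind N) (G_ind N) (mf_d (G_ind N)) B =
      Pcomp (G_ind M) (G_ind M) (G_ind N) B (mf_d (G_ind M)) ->
    a' != a -> b' != b ->
    gapG M N b a + 2 * pi * m%:R + basic_exp N N a' a - basic_exp M M b' b =
      gapG M N b' a' + 2 * pi * z%:~R ->
  coefs (B a b) m = if z is Posz m' then coefs (B a' b') m' else 0.
Proof.
(* Only entry (a', b) of the equation d_N B = B d_M is needed. *)
move=> /matrixP/(_ a' b) comm na nb hz.
have ord2n (i j j' : 'I_2) : j' != j -> i != j -> i = j'.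
  by case: (ord2P i) (ord2P j) (ord2P j') => -> [] -> [] ->.
move: comm; rewrite !mxE (bigD1 a isT) big1 => [|j nj]; last first.
  by rewrite (ord2n _ _ _ na nj) mf_d_G_ind eqxx !mul0r.
rewrite [X in _ = X](bigD1 b' isT) [X in _ = _ + X]big1 => [|j nj]; last first.
  have -> : j = b by apply: ord2n nj; rewrite eq_sym.
  by rewrite [mf_d (G_ind M) _ _]mf_d_G_ind eqxx mulr0 mul0r.
rewrite !Monoid.mulm1 !mf_d_G_ind (negPf na) (negPf nb).
have [i iE iX] :=
  gap_then_epow k (point M b) (mf_d_exp_ge0 N a' a) (cls_mf_d N na).
have [j jE jX] :=
  epow_then_gap k (point N a') (mf_d_exp_ge0 M b' b) (cls_mf_d M nb).
rewrite -!summand_G_ind in iE iX jE jX.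
rewrite mulrAC iX [B a' b' * _]mulrC mulrAC jX => e.
have {e} : coefs (fpsX k ^+ i * B a b) (m + i) =
    coefs (fpsX k ^+ j * B a' b') (m + i).
  by rewrite e.
rewrite !coefs_XnM leq_addl addnK => ->.
(* Both ways round the square have the same length; compare them in units of [2 pi]. *)
have zE : z + j%:Z = (m + i)%N%:Z.
  apply/eqP; rewrite -(eqr_int R) intrD -!pmulrn natrD.
  apply/eqP/(mulfI (lt0r_neq0 (pi2_gt0 R))); lra.
(* If [z < 0], then [m + i < j], and a multiple of [t^j] has coefficient 0 there. *)
case: z zE {hz} => z zE; last by case: leqP => //; lia.
have -> : (j <= m + i)%N by lia.
by congr (coefs _ _); lia.
Qed.

(** For fullness: the whole block is recovered from its first-coordinate entry, from which the
    scalar for each [n] can be read off. *)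
Lemma comm_coefs_fst M N (B : 'M[fps k]_2) n a b a' b' (m : nat) :
    Pcomp (G_ind M) (G_ind N) (G_ind N) (mf_d (G_ind N)) B =
      Pcomp (G_ind M) (G_ind M) (G_ind N) B (mf_d (G_ind M)) ->
    is_fst M b == is_fst (Fs_iter s n N) a ->
    basic_exp M (Fs_iter s n N) a b = gapG M N b a + 2 * pi * m%:R ->
    is_fst M b' -> is_fst (Fs_iter s n N) a' ->
  coefs (B a b) m =
  if ind_le M (Fs_iter s n N) then
    coefs (B a' b')
      (Num.truncn (basic_exp M (Fs_iter s n N) a' b' / (2 * pi)))
  else 0.
Proof.
move=> comm /eqP mt hm fb' fa'.
have hm0 : 0 <= basic_exp M (Fs_iter s n N) a b.
  by rewrite hm addr_ge0 ?gap_ge0 // mulr_ge0 ?(ltW (pi2_gt0 R)).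
have trunc_gap (p q : circle R) (l : nat) :
    Num.truncn ((gap p q + 2 * pi * l%:R) / (2 * pi)) = l.
  have := epow_gapD k p q l; rewrite /epow.
  move=> /(congr1 (fun f => coefs f l)); rewrite !coefsXn eqxx.
  by case: eqP => // _ /eqP; rewrite eq_sym oner_eq0.
have other a1 b1 : a1 != a -> b1 != b -> coefs (B a b) m =
    if 0 <= basic_exp M (Fs_iter s n N) a1 b1 then
      coefs (B a1 b1) (Num.truncn (basic_exp M (Fs_iter s n N) a1 b1 / (2 * pi)))
    else 0.
  move=> na nb.
  have mt1 : is_fst M b1 == is_fst (Fs_iter s n N) a1.
    by rewrite (is_fst_neq M nb) (is_fst_neq _ na) mt.
  have [z hz] := exp_gapz mt1.
  rewrite (comm_coefs (z := z) comm na nb); last first.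
    rewrite -hm -hz !basic_exp_Fs /basic_exp; ring.
  rewrite hz; case: z {hz} => z.
    by rewrite -pmulrn addr_ge0 ?gap_ge0 ?trunc_gap // mulr_ge0 ?(ltW (pi2_gt0 R)).
  by rewrite leNgt gap_neg.
(* If [(a, b)] is that entry itself, commutation only matters for the vanishing when the other
   exponent is negative. *)
have [fb|nfb] := boolP (is_fst M b).
  have -> : b' = b by apply: (@is_fst_inj M); rewrite fb.
  have -> : a' = a by apply: (@is_fst_inj (Fs_iter s n N)); rewrite -mt fb.
  pose flip (i : 'I_2) : 'I_2 := if i == 0 then 1 else 0.
  have flipP i : flip i != i by case: (ord2P i) => ->.
  have mt' : is_fst M b == is_fst (Fs_iter s n N) a by rewrite mt.
  rewrite (ind_le_basic_exp mt' (flipP a) (flipP b)) hm0 andTb {1}hm trunc_gap.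
  by case: ifP => // h; rewrite (other _ _ (flipP a) (flipP b)) h.
have na : a' != a by apply: contraNneq nfb => aa; rewrite mt -aa.
have nb : b' != b by apply: contraNneq nfb => <-.
have mt' : is_fst M b == is_fst (Fs_iter s n N) a by rewrite mt.
by rewrite (ind_le_basic_exp mt' na nb) hm0 andTb (other _ _ na nb).
Qed.

Lemma ind_eq_G (x y : R) (h : x <= y <= x + 2 * pi) :
    x + (pi - r * pi / s) <= y <= x + 2 * pi - (pi - r * pi / s) ->
  exists M, G_ind M = mfE k h.
Proof.
have pV (u : R) : pi / s * (s / pi * u) = u.
  have s0 := lt0r_neq0 s_gt0; have p0 := lt0r_neq0 (pi_gt0 R).
  by rewrite !mulrA divfK // mulfV // mul1r.
move=> /andP[h1 h2].
(* The hypothesis says that [x] and [y - pi] are at distance at most [r * pi / s]; scale by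
   [s / pi]. *)
have bound : `|s / pi * x - s / pi * (y - pi)| <= r.
  rewrite -mulrBr normrM gtr0_norm ?divr_gt0 ?pi_gt0 //.
  rewrite mulrAC ler_pdivrMr ?pi_gt0 // mulrC -ler_pdivlMr // ler_norml.
  by apply/andP; split; lra.
exists (@Ind R r (s / pi * x) (s / pi * (y - pi)) true bound).
by apply: eq_mfE; rewrite /G_fst /G_snd /= !pV ?subrK.
Qed.

End Coordinates.

(** * Coefficients of [Ghat], faithfulness and fullness *)

Section Ghat.
Variables (k : fieldType) (R : realType) (r s : R).
Hypotheses (r_gt0 : 0 < r) (le_rs : r <= s).
Implicit Types (X Y : dsum (ind r)).
Local Notation G_ind := (G_ind k r_gt0 le_rs).
Local Notation G_ob := (G_ob k r_gt0 le_rs).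
Local Notation Ghat_mx := (Ghat_mx r_gt0 le_rs).
Local Notation point M a := (@summand _ (mf_ob (G_ind M)) a).

Lemma Bhom0 X Y (f : Bhom k X Y) i j : ~~ ind_le (X j) (Y i) -> val f i j = 0.
Proof. by move: i j; apply/is_BhomP/(valP f). Qed.

Lemma index_ex Y (i : 'I_(rank Y)) (a : 'I_2) : exists I : 'I_(rank (G_ob Y)),
  tagnat.sig1 I = i /\ tagnat.sig2 I = a :> 'I_2.
Proof.
exists (tagnat.Rank i a); split; first exact: tagnat.Rank1K.
by apply: val_inj; rewrite /= tagnat.Rank2K.
Qed.

(** At a fixed entry the exponent is injective in [n], so each power of [t] receives the
    contribution of a single component of [f]. *)
Lemma coefs_Ghat X Y (f : orbit_hom k s X Y) n
    (I : 'I_(rank (G_ob Y))) (J : 'I_(rank (G_ob X))) m :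
    let N := Y (tagnat.sig1 I) in let M := X (tagnat.sig1 J) in
    let a := tagnat.sig2 I in let b := tagnat.sig2 J in
    is_fst M b == is_fst (Fs_iter s n N) a ->
    basic_exp s M (Fs_iter s n N) a b =
      gap (point M b) (point N a) + 2 * pi * m%:R ->
  coefs (Ghat_mx f I J) m = val (f n) (tagnat.sig1 I) (tagnat.sig1 J).
Proof.
move=> N M a b mt hm.
have GnE l : coefs ((val (G_hom r_gt0 le_rs (f l)) :
      'M[fps k]_(rank (G_ob Y), rank (G_ob X))) I J) m =
    val (f l) (tagnat.sig1 I) (tagnat.sig1 J) *
    coefs (G_basic k s M (Fs_iter s l N) a b) m.
  by rewrite /= /G_mx !mxE coefsCM.
rewrite mxE /= (@fsum_seq _ _ [:: n]) //.
  rewrite big_seq1 GnE G_basic_entry mt hm epow_gapD coefsXn eqxx mulr1 //.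
move=> l; rewrite GnE mulf_eq0 negb_or => /andP[nz]; rewrite inE.
rewrite G_basic_entry; case: ifP => [mt' nz'|_]; last by rewrite coefs0 eqxx.
(* Nonnegativity matters: [epow] truncates, so a negative exponent would also give [t^0]. *)
have le : ind_le M (Fs_iter s l N).
  by apply: contraNT nz => nle; rewrite Bhom0.
have [m' hm'] := exp_gap_nat k r_gt0 le_rs mt' (basic_exp_ge0 r_gt0 le_rs mt' le).
apply/eqP/(basic_exp_inj r_gt0 le_rs (M := M) (N := N) (a := a) (b := b)).
rewrite hm hm'; move: nz'; rewrite hm' epow_gapD coefsXn.
by case: (m =P m') => [-> //|_]; rewrite eqxx.
Qed.

Definition fst_index (M : ind r) : 'I_2 := if pos M then 0 else 1.

Lemma is_fst_index M : is_fst M (fst_index M).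
Proof. by rewrite /is_fst /fst_index; case: (pos M). Qed.

Lemma Ghat_faithful X Y (f g : orbit_hom k s X Y) :
  Ghat_mx f = Ghat_mx g -> f = g.
Proof.
move=> fg; apply: orbit_homP => n; apply/matrixP => i j.
have [le|nle] := boolP (ind_le (X j) (Fs_iter s n (Y i))); last first.
  exact: etrans (@Bhom0 _ _ (f n) i j nle) (esym (@Bhom0 _ _ (g n) i j nle)).
have := is_fst_index (X j); have := is_fst_index (Fs_iter s n (Y i)).
have [I [Ii <-]] := index_ex i (fst_index (Fs_iter s n (Y i))).
have [J [Jj <-]] := index_ex j (fst_index (X j)); subst i j => fa fb.
have mt := introT eqP (etrans fb (esym fa)).
have [m hm] := exp_gap_nat k r_gt0 le_rs mt (basic_exp_ge0 r_gt0 le_rs mt le).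
by rewrite -(coefs_Ghat f mt hm) fg (coefs_Ghat g mt hm).
Qed.

Lemma Ghat_full X Y (g : mf_hom (G_ob X) (G_ob Y)) :
  exists f : orbit_hom k s X Y, Ghat_hom r_gt0 le_rs f = g.
Proof.
pose B i j : 'M[fps k]_2 := submxblock (val g) i j.
have gE : val g = \mxblock_(i, j) B i j by rewrite submxblockK.
have comm i j :
    Pcomp (G_ind (X j)) (G_ind (Y i)) (G_ind (Y i)) (mf_d (G_ind (Y i))) (B i j) =
    Pcomp (G_ind (X j)) (G_ind (X j)) (G_ind (Y i)) (B i j) (mf_d (G_ind (X j))).
  have /eqP := valP g; rewrite gE.
  rewrite (@Pcomp_mxdiagl k R _ _ (fun i => G_ind (Y i)) (fun i => G_ind (X i))
    (fun i => mf_d (G_ind (Y i)))).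
  rewrite (@Pcomp_mxdiagr k R _ _ (fun i => G_ind (Y i)) (fun i => G_ind (X i))
    (fun i => mf_d (G_ind (X i)))).
  by move=> /eq_mxblockP.
(* The scalar for [n] is the coefficient, in the first-coordinate entry of the block, of the power
   of [t] given by the exponent at [n]. *)
pose F n i j : k := if ind_le (X j) (Fs_iter s n (Y i)) then
    coefs (B i j (fst_index (Fs_iter s n (Y i))) (fst_index (X j)))
      (Num.truncn (basic_exp s (X j) (Fs_iter s n (Y i))
         (fst_index (Fs_iter s n (Y i))) (fst_index (X j)) / (2 * pi)))
  else 0.
have FP n : @is_Bhom k R r X (Fspow_ob s n Y) (\matrix_(i, j) F n i j).
  by apply/is_BhomP => i j nle; rewrite mxE /F (negPf nle).
exists (fun n => Sub _ (FP n)); apply: val_inj; apply/matrixP => I J.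
apply: fpsP => m /=.
have [n [mt hm]] := exp_gap_ex k r_gt0 le_rs
  (X (tagnat.sig1 J)) (Y (tagnat.sig1 I)) (tagnat.sig2 I) (tagnat.sig2 J) m.
rewrite (coefs_Ghat _ mt hm) /= mxE gE mxE.
by rewrite (comm_coefs_fst (comm _ _) mt hm (is_fst_index _) (is_fst_index _)).
Qed.

End Ghat.

(** * Essential surjectivity and the equivalence *)

Theorem theorem2p3p1 (k : fieldType) (R : realType) (r s : R)
    (r_gt0 : 0 < r) (le_rs : r <= s) :
  is_equivalence (Ghat k r_gt0 le_rs).
Proof.
apply: is_equivalence_ff => [X Y g|X Y f f' /(congr1 val)|].
- exact: Ghat_full.
- exact: Ghat_faithful.
move=> [Z [n [x [y [h [xy iso]]]]]].
(* Each [E(x, y)] is equal, not merely isomorphic, to the image of an indecomposable, so the direct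
   sums are equal as well. *)
have /choice[M ME] i := ind_eq_G k r_gt0 le_rs (h i) (xy i).
exists (DSum M).
have GM : G_ob k r_gt0 le_rs (DSum M) = mf_dsum (fun i => mfE k (h i)).
  by rewrite /G_ob /=; congr mf_dsum; apply/functional_extensionality_dep.
have : @isom (Fcat k R) (G_ob k r_gt0 le_rs (DSum M)) Z.
  by rewrite GM; have [f [g [gf fg]]] := iso; exists g, f.
by move=> [f [g fgK]]; exists f, g.
Qed.
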